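(* Let $Y_{\mathbb N}=\{y_{n1},y_{n2}:n\in\mathbb N\}$ be a countably infinite set in the open square $(-1,1)^2$, and $\{W_n:n\in\mathbb N\}$ a family of pairwise disjoint countable sets in $(-1,1)^2-Y_{\mathbb N}$, each $W_n$ dense in $[-1,1]^2$. Suppose that (1) $\lim_{n\to\infty}d(y_{n1},J_1)=\lim_{n\to\infty}d(y_{n2},J_{-1})=0$; and (2) for every $\beta\in p(Y_{\mathbb N})$ there exists $\varepsilon_\beta>0$ such that $Y_{\mathbb N}\cap p^{-1}([\beta-\varepsilon_\beta,\beta+\varepsilon_\beta])$ is finite. Then there exists a homeomorphism $\psi:[-1,1]^2\to[-1,1]^2$ with zero topological entropy such that for every $n\in\mathbb N$ and every $w\in W_n$, $\omega_\psi(w)=\{y_{n1}\}$ and $\alpha_\psi(w)=\{y_{n2}\}$.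
   Context: $J_i=[-1,1]\times\{i\}$ for $i\in\{-1,1\}$; $d$ is the Euclidean metric and $d(y,J_i)=\inf_{z\in J_i}d(y,z)$. $p:\mathbb R^2\to\mathbb R$ is the projection $p(r,s)=r$. $\omega_\psi(w)$ is the $\omega$-limit set of $w$ under $\psi$ and $\alpha_\psi(w)=\omega_{\psi^{-1}}(w)$. *)

(* Defs.v *)
From Stdlib Require Import Reals Lra List.
Open Scope R_scope.

Definition pt := (R * R)%type.

Definition d (a b : pt) : R :=
  sqrt ((fst a - fst b) ^ 2 + (snd a - snd b) ^ 2).

Definition p (a : pt) : R := fst a.

Definition closed_sq (a : pt) : Prop :=
  -1 <= fst a <= 1 /\ -1 <= snd a <= 1.
Definition open_sq (a : pt) : Prop :=
  -1 < fst a < 1 /\ -1 < snd a < 1.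

Definition J (i : R) (a : pt) : Prop := -1 <= fst a <= 1 /\ snd a = i.

(* d(y_n, J) -> 0, unfolded: d(y,J) = inf_{z in J} d(y,z) >= 0,
   so the limit is 0 iff for every eps there are eventually points of J
   within eps. *)
Definition dist_to_tends_to_0 (y : nat -> pt) (A : pt -> Prop) : Prop :=
  forall eps, eps > 0 -> exists N : nat, forall n : nat, (n >= N)%nat ->
    exists z, A z /\ d (y n) z < eps.

Definition finite_set (A : pt -> Prop) : Prop :=
  exists l : list pt, forall x, A x -> In x l.
Definition countable_set (A : pt -> Prop) : Prop :=
  exists f : nat -> pt, forall x, A x -> exists k : nat, f k = x.

Definition dense_in_sq (A : pt -> Prop) : Prop :=
  forall z, closed_sq z -> forall eps, eps > 0 ->
    exists w, A w /\ d w z < eps.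

Definition continuous_on_sq (f : pt -> pt) : Prop :=
  forall x, closed_sq x -> forall eps, eps > 0 -> exists delta, delta > 0 /\
    forall x', closed_sq x' -> d x x' < delta -> d (f x) (f x') < eps.

Definition homeo_sq (psi phi : pt -> pt) : Prop :=
  (forall x, closed_sq x -> closed_sq (psi x)) /\
  (forall x, closed_sq x -> closed_sq (phi x)) /\
  (forall x, closed_sq x -> phi (psi x) = x) /\
  (forall x, closed_sq x -> psi (phi x) = x) /\
  continuous_on_sq psi /\ continuous_on_sq phi.

Definition iter (f : pt -> pt) (n : nat) (x : pt) : pt := Nat.iter n f x.

Definition omega_limit (f : pt -> pt) (w : pt) (z : pt) : Prop :=
  forall eps, eps > 0 -> forall N : nat, exists n : nat, (n >= N)%nat /\
    d (iter f n w) z < eps.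

Definition separated (f : pt -> pt) (n : nat) (eps : R) (E : list pt) : Prop :=
  NoDup E /\ (forall x, In x E -> closed_sq x) /\
  forall x y, In x E -> In y E -> x <> y ->
    exists i : nat, (i < n)%nat /\ d (iter f i x) (iter f i y) > eps.

(* Topological entropy of f on the compact metric space [-1,1]^2 is zero:
   h(f) = lim_{eps->0} limsup_n (1/n) log s(n,eps), with s(n,eps) the maximal
   cardinality of an (n,eps)-separated set; since h >= 0, h = 0 iff for every
   eps > 0, limsup_n (1/n) log s(n,eps) <= 0, unfolded below. *)
Definition zero_top_entropy (f : pt -> pt) : Prop :=
  forall eps, eps > 0 -> forall delta, delta > 0 ->
    exists N : nat, forall n : nat, (n >= N)%nat ->
      forall E, separated f n eps E -> INR (length E) <= exp (delta * INR n).

(* Main.v *)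
Require Import Defs.
From Stdlib Require Import Reals List.
From Stdlib Require Import Lra Lia ZArith Cantor.
From Stdlib Require Import Classical ClassicalEpsilon.
Open Scope R_scope.

(** After a shear, all points of the family have distinct abscissas.  The upper
    comb is the top side together with the vertical teeth from the top side
    down to the points [y1 n]; the lower comb is defined likewise from the
    [y2 n].  The square minus the combs is foliated by graphs [t = const],
    [t] in R, which climb from the lower to the upper comb: they are built from
    infimal convolutions with cones at the tooth ends, whose slopes grow like
    [|t| ^ (1/4)].

    In the coordinates [(r, t)] the homeomorphism is [(r, t) |-> (f_t r, t + 1)],
    and it is the identity elsewhere.  Here [f_t] pushes [r] by about
    [|t| ^ (-1/2)] towards a target [c t].  Displacements tend to [0] as [|t|]
    grows, since [|t| ^ (-1/2)] beats the slopes; yet the sum of the pushes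
    diverges, so an orbit converges to any target which is eventually constant
    along it.  As the orbit of [w] keeps [t mod 1] fixed, it suffices that
    points of different sets [W n] have different phases [t mod 1], which a
    generic slanting of the time [t] achieves, and that [c] takes at [t + k]
    the abscissa of [y1 n] for large [k], and at [t - k] that of [y2 n].

    Every orbit moves by a definite amount only during a time window of bounded
    length, hence the entropy is zero. *)

(** * Zero entropy of maps with slow orbits *)

(** Convergence of the abscissas alone would not give convergence of the points: near a tooth the
    leaf of time [t] can have slope about [t ^ (1/4)], so the abscissa must approach the tooth
    faster than [t ^ (-1/4)]. Pushes of relative size [j ^ (-1/2)] are more than enough, and a rate
    [1 / j] is all that is recorded. The exponents meet two opposite demands: slopes tend to
    infinity, so that the leaves exhaust the complement of the combs, while slope times push tends
    to [0], so that the map extends continuously by the identity.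

    All [W n] being dense, no open part of the square can be assigned to a single limit; the target
    is therefore a function of [t] alone. Separate phases make countably many conditions on this one
    function compatible, and letting the [i]-th condition start only at [|t| >= i + 1] keeps them
    locally finite, even if the phases are dense. The shear ensures that teeth do not overlap and
    that no point of a [W n] lies on a tooth, where it could be fixed. *)

Lemma fst_le_d (a b : pt) : Rabs (fst a - fst b) <= d a b.
Proof.
  unfold d. rewrite <- sqrt_Rsqr_abs. apply sqrt_le_1_alt. unfold Rsqr.
  pose proof (pow2_ge_0 (snd a - snd b)). nra.
Qed.

Lemma snd_le_d (a b : pt) : Rabs (snd a - snd b) <= d a b.
Proof.
  unfold d. rewrite <- sqrt_Rsqr_abs. apply sqrt_le_1_alt. unfold Rsqr.
  pose proof (pow2_ge_0 (fst a - fst b)). nra.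
Qed.

Lemma d_le_sum (a b : pt) :
  d a b <= Rabs (fst a - fst b) + Rabs (snd a - snd b).
Proof.
  unfold d. set (u := fst a - fst b). set (v := snd a - snd b).
  pose proof (Rabs_pos u). pose proof (Rabs_pos v).
  rewrite <- (sqrt_Rsqr (Rabs u + Rabs v)) by lra.
  apply sqrt_le_1_alt. unfold Rsqr.
  rewrite <- (pow2_abs u), <- (pow2_abs v). nra.
Qed.

Lemma d_tri (a b c : pt) : d a c <= d a b + d b c.
Proof.
  pose proof (triangle (fst a) (snd a) (fst c) (snd c) (fst b) (snd b)) as H.
  unfold dist_euc, Rsqr in H. unfold d. 
  replace ((fst a - fst c) ^ 2 + (snd a - snd c) ^ 2)
    with ((fst a - fst c) * (fst a - fst c) + (snd a - snd c) * (snd a - snd c)) by ring.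
  replace ((fst a - fst b) ^ 2 + (snd a - snd b) ^ 2)
    with ((fst a - fst b) * (fst a - fst b) + (snd a - snd b) * (snd a - snd b)) by ring.
  replace ((fst b - fst c) ^ 2 + (snd b - snd c) ^ 2)
    with ((fst b - fst c) * (fst b - fst c) + (snd b - snd c) * (snd b - snd c)) by ring.
  exact H.
Qed.

Lemma d_sym (a b : pt) : d a b = d b a.
Proof. unfold d. f_equal. ring. Qed.

Lemma d_refl (a : pt) : d a a = 0.
Proof.
  apply Rle_antisym; [|apply sqrt_pos].
  eapply Rle_trans; [apply d_le_sum|].
  rewrite !Rminus_diag, Rabs_R0. lra.
Qed.

Lemma d_eq (a b : pt) : d a b <= 0 -> a = b.
Proof.
  intros H. destruct a as [a1 a2], b as [b1 b2].
  pose proof (fst_le_d (a1, a2) (b1, b2)) as H1.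
  pose proof (snd_le_d (a1, a2) (b1, b2)) as H2. simpl in *.
  split_Rabs; f_equal; lra.
Qed.

Lemma iter_S (f : pt -> pt) (n : nat) (x : pt) :
  Defs.iter f (S n) x = f (Defs.iter f n x).
Proof. reflexivity. Qed.

Lemma iter_closed (f : pt -> pt) (n : nat) (x : pt) :
  (forall z, closed_sq z -> closed_sq (f z)) ->
  closed_sq x -> closed_sq (Defs.iter f n x).
Proof. intros Hf Hx. induction n; simpl; auto. Qed.

Definition converges_to (f : pt -> pt) (w y : pt) : Prop :=
  forall eps, eps > 0 -> exists N, forall n, (n >= N)%nat ->
     d (Defs.iter f n w) y < eps.

Lemma omega_limit_of_cv (f : pt -> pt) (w y : pt) : converges_to f w y ->
  forall z, omega_limit f w z <-> z = y.
Proof.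
  intros Hcv z; split.
  - intros Hz. apply d_eq. apply Rnot_lt_le; intros Hd.
    destruct (Hcv (d z y / 2) ltac:(lra)) as [N HN].
    destruct (Hz (d z y / 2) ltac:(lra) N) as [n [Hn Hn2]].
    pose proof (d_tri z (Defs.iter f n w) y) as H. pose proof (HN n Hn).
    rewrite (d_sym z (Defs.iter f n w)) in H. lra.
  - intros -> eps Heps N. destruct (Hcv eps Heps) as [N' HN'].
    exists (max N N'). split; [lia|apply HN'; lia].
Qed.

Fixpoint words {X : Type} (A : list X) (n : nat) : list (list X) :=
  match n with
  | O => nil :: nil
  | S m => map (fun q => fst q :: snd q) (list_prod A (words A m))
  end.

Lemma words_length {X : Type} (A : list X) (n : nat) :
  length (words A n) = (length A ^ n)%nat.
Proof.
  induction n; simpl; auto. rewrite length_map, length_prod, IHn. reflexivity.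
Qed.

Lemma in_words {X : Type} (A : list X) (l : list X) :
  (forall x, In x l -> In x A) -> In l (words A (length l)).
Proof.
  induction l as [|x l IH]; simpl; intros H; [auto|].
  apply in_map_iff. exists (x, l). split; auto. apply in_prod; auto.
Qed.

Lemma length_le_codes {X Y : Type} (code : X -> Y) (E : list X) (C : list Y) :
  NoDup E -> (forall x, In x E -> In (code x) C) ->
  (forall x y, In x E -> In y E -> code x = code y -> x = y) ->
  (length E <= length C)%nat.
Proof.
  intros HE HC Hinj. rewrite <- (length_map code E). apply NoDup_incl_length.
  - clear HC. induction HE as [|x E Hx HE IH]; simpl; constructor.
    + intros Hin. apply in_map_iff in Hin. destruct Hin as [y [Hy HyE]].
      apply Hx. rewrite (Hinj x y); simpl; auto.
    + apply IH. intros; apply Hinj; simpl; auto.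
  - intros c Hc. apply in_map_iff in Hc. destruct Hc as [x [<- Hx]]. auto.
Qed.

Lemma square_totally_bounded (eps : R) : eps > 0 ->
  exists (A : list (nat * nat)) (cell : pt -> nat * nat),
    (1 <= length A)%nat /\
    (forall z, closed_sq z -> In (cell z) A) /\
    (forall z z', closed_sq z -> closed_sq z' -> cell z = cell z' -> d z z' <= eps).
Proof.
  intros Heps.
  destruct (archimed_cor1 (eps / 2) ltac:(lra)) as [K [HK HK0]].
  assert (HKpos : 0 < INR K) by (apply lt_0_INR; lia).
  set (q := fun x : R => Z.to_nat (up ((x + 1) * INR K))).
  set (A := list_prod (seq 0 (2 * K + 2)) (seq 0 (2 * K + 2))).
  assert (Hq : forall x, -1 <= x <= 1 -> In (q x) (seq 0 (2 * K + 2))).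
  { intros x Hx. apply in_seq. unfold q.
    destruct (archimed ((x + 1) * INR K)) as [Hu1 Hu2].
    assert (Hlt : IZR (up ((x + 1) * INR K)) < IZR (2 * Z.of_nat K + 2)).
    { rewrite plus_IZR, mult_IZR, <- INR_IZR_INZ. nra. }
    apply lt_IZR in Hlt. lia. }
  assert (Hqq : forall x y, -1 <= x <= 1 -> -1 <= y <= 1 -> q x = q y ->
                 Rabs (x - y) <= eps / 2).
  { intros x y Hx Hy Hxy. unfold q in Hxy.
    destruct (archimed ((x + 1) * INR K)) as [Hu1 Hu2].
    destruct (archimed ((y + 1) * INR K)) as [Hv1 Hv2].
    (* [Z.to_nat] collapses negative integers; positivity of both sides lets equality of cells give
       equality of the integers. *)
    assert (H1 : (0 < up ((x + 1) * INR K))%Z) by (apply lt_IZR; simpl; nra).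
    assert (H2 : (0 < up ((y + 1) * INR K))%Z) by (apply lt_IZR; simpl; nra).
    assert (He : up ((x + 1) * INR K) = up ((y + 1) * INR K)) by lia.
    rewrite He in Hu1, Hu2.
    assert (Hb : Rabs (x - y) * INR K <= 1).
    { rewrite <- (Rabs_pos_eq (INR K)) at 1 by lra. rewrite <- Rabs_mult.
      apply Rabs_le. nra. }
    apply Rle_trans with (/ INR K); [|lra].
    apply Rmult_le_reg_r with (INR K); auto. rewrite Rinv_l; lra. }
  exists A, (fun z => (q (fst z), q (snd z))). split; [|split].
  - unfold A. rewrite length_prod, length_seq. nia.
  - intros z [Hz1 Hz2]. apply in_prod; auto.
  - intros z z' [Hz1 Hz2] [Hz1' Hz2'] He. injection He as He1 He2.
    eapply Rle_trans; [apply d_le_sum|].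
    pose proof (Hqq _ _ Hz1 Hz1' He1). pose proof (Hqq _ _ Hz2 Hz2' He2). lra.
Qed.

Lemma drift (f : pt -> pt) (x : pt) (eta : R) (s m : nat) :
  (forall i, (s <= i < s + m)%nat ->
     d (Defs.iter f (S i) x) (Defs.iter f i x) < eta) ->
  d (Defs.iter f (s + m) x) (Defs.iter f s x) <= INR m * eta.
Proof.
  induction m; intros H.
  - rewrite Nat.add_0_r, d_refl. simpl. lra.
  - rewrite S_INR. specialize (IHm ltac:(intros; apply H; lia)).
    pose proof (H (s + m)%nat ltac:(lia)) as H1.
    pose proof (d_tri (Defs.iter f (S (s + m)) x) (Defs.iter f (s + m) x) (Defs.iter f s x)).
    replace (s + S m)%nat with (S (s + m)) by lia. lra.
Qed.

Lemma exp_mult_INR (x : R) (n : nat) : exp (INR n * x) = exp x ^ n.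
Proof.
  induction n.
  - simpl. rewrite Rmult_0_l. apply exp_0.
  - rewrite S_INR. replace ((INR n + 1) * x) with (x + INR n * x) by ring.
    rewrite exp_plus, IHn. reflexivity.
Qed.

(** The exponent is spent in thirds: one on [N ^ (n / M)], by the choice of [M]; one on the linear
    factor; one on the constants, which are absorbed for large [n]. *)
Lemma subexponential (N M D : nat) (delta : R) :
  (1 <= N)%nat -> (1 <= M)%nat -> delta > 0 ->
  ln (INR N) <= INR M * (delta / 3) ->
  exists n0, forall n, (n >= n0)%nat ->
    INR (N ^ (n / M + 1) * ((n + 1) * N ^ D)) <= exp (delta * INR n).
Proof.
  intros HN HM Hdelta HNM.
  assert (HNp : 0 < INR N) by (apply lt_0_INR; lia).
  (* [k <= 1] gives [n + 1 <= / k * (1 + k * n)], and [k <= delta / 3] puts [1 + k * n] below the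
     exponential. *)
  set (k := Rmin 1 (delta / 3)).
  assert (Hk : 0 < k <= 1 /\ k <= delta / 3).
  { unfold k. pose proof (Rmin_l 1 (delta / 3)). pose proof (Rmin_r 1 (delta / 3)).
    pose proof (Rmin_glb_lt 1 (delta / 3) 0). lra. }
  set (C := INR N * / k * INR N ^ D).
  assert (HC : 0 < C).
  { unfold C. apply Rmult_lt_0_compat; [apply Rmult_lt_0_compat|]; auto.
    apply Rinv_0_lt_compat; lra. apply pow_lt; auto. }
  destruct (INR_unbounded (C / (delta / 3))) as [n0 Hn0].
  exists n0. intros n Hn.
  assert (HnR : INR n0 <= INR n) by (apply le_INR; lia).
  assert (H1 : C <= exp (delta / 3 * INR n)).
  { apply Rle_trans with (1 + delta / 3 * INR n).
    - assert (C < INR n * (delta / 3)); [|lra].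
      replace C with (C / (delta / 3) * (delta / 3)) by (field; lra).
      apply Rmult_lt_compat_r; lra.
    - destruct (Req_dec (delta / 3 * INR n) 0) as [E|E].
      + rewrite E, exp_0. lra.
      + left. apply exp_ineq1. exact E. }
  assert (H2 : INR n + 1 <= / k * exp (delta / 3 * INR n)).
  { pose proof (pos_INR n).
    apply Rle_trans with (/ k * (1 + k * INR n)).
    - rewrite Rmult_plus_distr_l, <- Rmult_assoc, Rinv_l by lra.
      assert (1 <= / k). { rewrite <- Rinv_1. apply Rinv_le_contravar; lra. } lra.
    - apply Rmult_le_compat_l. left; apply Rinv_0_lt_compat; lra.
      apply Rle_trans with (1 + delta / 3 * INR n). nra.
      destruct (Req_dec (delta / 3 * INR n) 0) as [E|E].
      + rewrite E, exp_0. lra.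
      + left. apply exp_ineq1. exact E. }
  assert (H3 : INR N ^ (n / M) <= exp (delta / 3 * INR n)).
  { rewrite <- (exp_ln (INR N)) at 1 by auto. rewrite <- exp_mult_INR.
    assert (Hdiv : INR (n / M) * INR M <= INR n).
    { rewrite <- mult_INR. apply le_INR.
      rewrite Nat.mul_comm. apply Nat.Div0.mul_div_le. }
    assert (Hle : INR (n / M) * ln (INR N) <= delta / 3 * INR n).
    { pose proof (pos_INR (n / M)). 
      apply Rle_trans with (INR (n / M) * (INR M * (delta / 3))).
      apply Rmult_le_compat_l; auto. nra. }
    destruct Hle as [Hle|Hle].
    - left. apply exp_increasing; auto.
    - rewrite Hle. lra. }
  rewrite !mult_INR, !pow_INR, plus_INR, pow_add, pow_1. simpl (INR 1).
  replace (delta * INR n) with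
    (delta / 3 * INR n + (delta / 3 * INR n + delta / 3 * INR n)) by field.
  rewrite !exp_plus. set (e := exp (delta / 3 * INR n)) in *.
  assert (He : 0 < e) by apply exp_pos.
  assert (HNnM : 0 < INR N ^ (n / M)) by (apply pow_lt; auto).
  assert (HND : 0 < INR N ^ D) by (apply pow_lt; auto).
  pose proof (pos_INR n).
  apply Rle_trans with (e * INR N * (/ k * e * INR N ^ D)).
  - apply Rmult_le_compat; [nra|nra| |].
    + apply Rmult_le_compat_r; lra.
    + apply Rmult_le_compat_r; lra.
  - replace (e * INR N * (/ k * e * INR N ^ D)) with (e * e * C)
      by (unfold C; ring).
    rewrite Rmult_assoc. apply Rmult_le_compat_l; [lra|].
    apply Rmult_le_compat_l; lra.
Qed.

Definition slow_orbits (f : pt -> pt) : Prop :=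
  forall eta, eta > 0 -> exists L : nat, forall x, closed_sq x ->
     exists a : nat, forall i : nat,
       eta <= d (Defs.iter f (S i) x) (Defs.iter f i x) -> (a <= i < a + L)%nat.

(* An orbit that is slow outside a time window of bounded length is determined
   up to [eps] by its cells at the multiples of [M], the start of its window,
   and its cells during the window and the next [M] steps. *)
Lemma zero_entropy_of_slow_orbits (f : pt -> pt) :
  (forall z, closed_sq z -> closed_sq (f z)) ->
  slow_orbits f -> zero_top_entropy f.
Proof.
  intros Hf Hslow eps Heps delta Hdelta.
  destruct (square_totally_bounded (eps / 2) ltac:(lra)) as (A & cell & HA & Hcell & Hcc).
  destruct (INR_unbounded (ln (INR (length A)) / (delta / 3))) as [M0 HM0].
  set (M := S M0).
  assert (HM : ln (INR (length A)) <= INR M * (delta / 3)).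
  { unfold M. rewrite S_INR.
    replace (ln (INR (length A))) with
      (ln (INR (length A)) / (delta / 3) * (delta / 3)) by (field; lra).
    apply Rmult_le_compat_r; lra. }
  assert (HMp : 0 < INR M) by (apply lt_0_INR; unfold M; lia).
  (* A slow stretch of at most [M] steps drifts by at most [eps / 4]; two such drifts and a common
     cell of diameter [eps / 2] add up to [eps]. *)
  set (eta := eps / 4 / INR M).
  assert (Heta : eta > 0) by (unfold eta; repeat apply Rdiv_lt_0_compat; lra).
  destruct (Hslow eta Heta) as [L HL].
  assert (Hex : forall x, exists a : nat, closed_sq x -> forall i : nat,
       eta <= d (Defs.iter f (S i) x) (Defs.iter f i x) -> (a <= i < a + L)%nat).
  { intros x. destruct (classic (closed_sq x)) as [Hx|Hx].
    - destruct (HL x Hx) as [a Ha]. exists a; auto.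
    - exists O; intros; contradiction. }
  set (start := fun x => proj1_sig (constructive_indefinite_description _ (Hex x))).
  assert (Hstart : forall x, closed_sq x -> forall i : nat,
       eta <= d (Defs.iter f (S i) x) (Defs.iter f i x) -> (start x <= i < start x + L)%nat).
  { intros x. unfold start. destruct (constructive_indefinite_description _ (Hex x)); auto. }
  destruct (subexponential (length A) M (L + M) delta HA ltac:(unfold M; lia) Hdelta HM)
    as [n0 Hn0].
  exists n0. intros n Hn E (HE1 & HE2 & HE3).
  set (cells := fun x s m => map (fun i => cell (Defs.iter f i x)) (seq s m)).
  (* Truncating the start at [n] leaves finitely many codes; a window starting later contains no
     step before time [n]. *)
  set (code := fun x =>
    (map (fun j => cell (Defs.iter f (j * M) x)) (seq 0 (n / M + 1)),
      (min (start x) n,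
       map (fun i => cell (Defs.iter f (min (start x) n + i) x)) (seq 0 (L + M))))).
  set (C := list_prod (words A (n / M + 1)) (list_prod (seq 0 (n + 1)) (words A (L + M)))).
  eapply Rle_trans; [|apply Hn0, Hn].
  apply le_INR.
  replace (length A ^ (n / M + 1) * ((n + 1) * length A ^ (L + M)))%nat with (length C)
    by (unfold C; rewrite !length_prod, !words_length, length_seq; reflexivity).
  assert (Hw : forall x (g : nat -> nat) m, closed_sq x ->
    In (map (fun i => cell (Defs.iter f (g i) x)) (seq 0 m)) (words A m)).
  { intros x g m Hx.
    rewrite <- (length_seq m 0) at 2.
    rewrite <- (length_map (fun i => cell (Defs.iter f (g i) x)) (seq 0 m)) at 1.
    apply in_words. intros c Hc. apply in_map_iff in Hc. destruct Hc as [i [<- _]].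
    apply Hcell, iter_closed; auto. }
  apply (length_le_codes code); auto.
  - intros x Hx. unfold code, C. apply in_prod; [|apply in_prod].
    + apply (Hw x (fun j => (j * M)%nat)); auto.
    + apply in_seq. lia.
    + apply (Hw x (fun i => (min (start x) n + i)%nat)); auto.
  - intros x y Hx Hy Hcode. apply NNPP; intros Hxy.
    destruct (HE3 x y Hx Hy Hxy) as [i [Hi Hd]].
    apply HE2 in Hx, Hy. unfold code in Hcode. injection Hcode as Hc1 Hc2 Hc3.
    assert (Hcl : forall j z, closed_sq z -> closed_sq (Defs.iter f j z))
      by (intros; apply iter_closed; auto).
    (* A fast step since the last multiple of [M] puts [i] fewer than [L + M] steps after the start
       of the window, hence among the recorded cells. It also shows that the start is below [n], so
       the truncation is inert. *)
    assert (Hrec : forall u v, closed_sq u -> closed_sq v ->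
       min (start u) n = min (start v) n ->
       map (fun i => cell (Defs.iter f (min (start u) n + i) u)) (seq 0 (L + M)) =
       map (fun i => cell (Defs.iter f (min (start v) n + i) v)) (seq 0 (L + M)) ->
       (exists j, (i / M * M <= j < i)%nat /\
          eta <= d (Defs.iter f (S j) u) (Defs.iter f j u)) ->
       cell (Defs.iter f i u) = cell (Defs.iter f i v)).
    { intros u v Hu Hv Huv Hmap [j [Hj1 Hj2]].
      apply (Hstart u Hu) in Hj2.
      assert (HiM : (i < i / M * M + M)%nat).
      { pose proof (Nat.mod_upper_bound i M ltac:(unfold M; lia)).
        pose proof (Nat.div_mod_eq i M). lia. }
      rewrite <- Huv in Hmap.
      assert (Hs : min (start u) n = start u) by lia.
      rewrite Hs in Hmap.
      apply (f_equal (fun l => nth (i - start u) l (cell (Defs.iter f (start u + 0) u))))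
        in Hmap.
      rewrite (map_nth (fun i => cell (Defs.iter f (start u + i) u))) in Hmap.
      rewrite (nth_indep _ _ (cell (Defs.iter f (start u + 0) v))) in Hmap
        by (rewrite length_map, length_seq; lia).
      rewrite (map_nth (fun i => cell (Defs.iter f (start u + i) v))) in Hmap.
      rewrite seq_nth in Hmap by lia.
      replace (start u + (0 + (i - start u)))%nat with i in Hmap by lia. exact Hmap. }
    destruct (classic (exists j, (i / M * M <= j < i)%nat /\
          eta <= d (Defs.iter f (S j) x) (Defs.iter f j x))) as [Hbx|Hbx].
    { pose proof (Hcc _ _ (Hcl i x Hx) (Hcl i y Hy) (Hrec x y Hx Hy Hc2 Hc3 Hbx)). lra. }
    destruct (classic (exists j, (i / M * M <= j < i)%nat /\
          eta <= d (Defs.iter f (S j) y) (Defs.iter f j y))) as [Hby|Hby].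
    { pose proof (Hcc _ _ (Hcl i y Hy) (Hcl i x Hx)
        (Hrec y x Hy Hx (eq_sym Hc2) (eq_sym Hc3) Hby)) as H.
      rewrite d_sym in H. lra. }
    assert (Hdr : forall z, (~ exists j, (i / M * M <= j < i)%nat /\
          eta <= d (Defs.iter f (S j) z) (Defs.iter f j z)) ->
          d (Defs.iter f i z) (Defs.iter f (i / M * M) z) <= eps / 4).
    { intros z Hz.
      pose proof (Nat.mod_upper_bound i M ltac:(unfold M; lia)) as Hm.
      pose proof (Nat.div_mod_eq i M) as Hdm.
      replace i with (i / M * M + i mod M)%nat at 1 by lia.
      eapply Rle_trans; [apply (drift f z eta)|].
      - intros j Hj. apply Rnot_le_lt. intros Hle. apply Hz. exists j. split; auto. lia.
      - apply Rle_trans with (INR M * eta).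
        + apply Rmult_le_compat_r; [lra|]. apply le_INR; lia.
        + unfold eta. right. field. lra. }
    assert (Hst : cell (Defs.iter f (i / M * M) x) = cell (Defs.iter f (i / M * M) y)).
    { assert (HiM : (i / M < n / M + 1)%nat).
      { pose proof (Nat.Div0.div_le_mono i n M). lia. }
      apply (f_equal (fun l => nth (i / M) l (cell (Defs.iter f (0 * M) x)))) in Hc1.
      rewrite (map_nth (fun j => cell (Defs.iter f (j * M) x))) in Hc1.
      rewrite (nth_indep _ _ (cell (Defs.iter f (0 * M) y))) in Hc1
        by (rewrite length_map, length_seq; exact HiM).
      rewrite (map_nth (fun j => cell (Defs.iter f (j * M) y))) in Hc1.
      rewrite seq_nth in Hc1 by exact HiM. exact Hc1. }
    pose proof (Hcc _ _ (Hcl _ x Hx) (Hcl _ y Hy) Hst).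
    pose proof (Hdr x Hbx). pose proof (Hdr y Hby) as Hy4. rewrite d_sym in Hy4.
    pose proof (d_tri (Defs.iter f i x) (Defs.iter f (i / M * M) x) (Defs.iter f i y)).
    pose proof (d_tri (Defs.iter f (i / M * M) x) (Defs.iter f (i / M * M) y) (Defs.iter f i y)).
    lra.
Qed.

(** * Generic parameters and interpolation *)

(** Cantor's nested intervals: each step keeps an outer quarter of the interval, on the side away
    from [u n]. *)
Lemma exists_avoiding_sequence (u : nat -> R) (lo hi : R) : lo < hi ->
  exists x, lo < x < hi /\ forall n, u n <> x.
Proof.
  intros Hlh.
  set (step := fun (n : nat) (q : R * R) =>
    let (l, h) := q in
    if Rle_dec (u n) ((l + h) / 2) then ((l + 3 * h) / 4, h) else (l, (3 * l + h) / 4)).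
  (* Starting from the middle third keeps the limit strictly between [lo] and [hi]. *)
  set (q := fix q n := match n with
    | O => ((2 * lo + hi) / 3, (lo + 2 * hi) / 3)
    | S m => step m (q m) end).
  assert (Hlt : forall n, fst (q n) < snd (q n)).
  { induction n; simpl; [lra|]. unfold step. destruct (q n) as [l h]; simpl in *.
    destruct Rle_dec; simpl; lra. }
  assert (Hs : forall n, fst (q n) <= fst (q (S n)) /\ snd (q (S n)) <= snd (q n) /\
     (fst (q (S n)) <= u n <= snd (q (S n)) -> False)).
  { intros n. specialize (Hlt n). simpl. unfold step. destruct (q n) as [l h]; simpl in *.
    destruct Rle_dec; simpl; lra. }
  assert (Hm : forall n m, fst (q n) <= fst (q (m + n)%nat) /\ snd (q (m + n)%nat) <= snd (q n)).
  { intros n m. induction m; [simpl; lra|].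
    pose proof (Hs (m + n)%nat). simpl (S m + n)%nat. lra. }
  assert (Hlr : forall n m, fst (q n) <= snd (q m)).
  { intros n m. pose proof (Hm n m). pose proof (Hm m n).
    rewrite (Nat.add_comm n m) in *. pose proof (Hlt (m + n)%nat). lra. }
  destruct (completeness (fun x => exists n, x = fst (q n))) as [x [Hx1 Hx2]].
  { exists (snd (q O)). intros y [n ->]. apply Hlr. }
  { exists (fst (q O)), O. reflexivity. }
  assert (Hx : forall n, fst (q n) <= x <= snd (q n)).
  { intros n. split; [apply Hx1; eauto|]. apply Hx2. intros y [m ->]. apply Hlr. }
  exists x. split.
  - specialize (Hx O). simpl in Hx. lra.
  - intros n He. subst x. apply (proj2 (proj2 (Hs n))). apply Hx.
Qed.

(** A bad set with at most one point is captured by [epsilon], so the bad sets become a sequence to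
    avoid. Both generic parameters, the slant and the size of the shear, are found this way. *)
Lemma exists_avoiding_unique (Bad : nat -> R -> Prop) (lo hi : R) : lo < hi ->
  (forall n x y, Bad n x -> Bad n y -> x = y) ->
  exists x, lo < x < hi /\ forall n, ~ Bad n x.
Proof.
  intros Hlh Huniq.
  destruct (exists_avoiding_sequence (fun n => epsilon (inhabits 0) (Bad n)) lo hi Hlh)
    as [x [Hx Hn]].
  exists x. split; auto. intros n Hb. apply (Hn n).
  apply (Huniq n); auto. apply epsilon_spec. eauto.
Qed.

Definition clip (lo hi x : R) : R := Rmax lo (Rmin hi x).

Lemma clip_bounds (lo hi x : R) : lo <= hi -> lo <= clip lo hi x <= hi.
Proof. intros H. unfold clip, Rmax, Rmin. repeat destruct Rle_dec; lra. Qed.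

Lemma clip_id (lo hi x : R) : lo <= x <= hi -> clip lo hi x = x.
Proof. intros H. unfold clip, Rmax, Rmin. repeat destruct Rle_dec; lra. Qed.

Lemma clip_low (lo hi x : R) : x <= lo -> lo <= hi -> clip lo hi x = lo.
Proof. intros H H'. unfold clip, Rmax, Rmin. repeat destruct Rle_dec; lra. Qed.

Lemma clip_high (lo hi x : R) : hi <= x -> lo <= hi -> clip lo hi x = hi.
Proof. intros H H'. unfold clip, Rmax, Rmin. repeat destruct Rle_dec; lra. Qed.

Lemma continuity_of_eps (f : R -> R) :
  (forall x eps, eps > 0 -> exists delta, delta > 0 /\
     forall y, Rabs (y - x) < delta -> Rabs (f y - f x) < eps) ->
  continuity f.
Proof.
  intros H x eps Heps. destruct (H x eps Heps) as [delta [Hd H']].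
  exists delta. split; auto. intros y [_ Hy]. apply H', Hy.
Qed.

Lemma eps_of_continuity (f : R -> R) (x eps : R) : continuity f -> eps > 0 ->
  exists delta, delta > 0 /\
     forall y, Rabs (y - x) < delta -> Rabs (f y - f x) < eps.
Proof.
  intros H Heps. destruct (H x eps Heps) as [delta [Hd H']].
  exists delta. split; auto. intros y Hy. destruct (Req_dec x y) as [->|Hxy].
  - rewrite Rminus_diag, Rabs_R0. lra.
  - apply (H' y). repeat split; auto.
Qed.

Lemma continuity_clip (lo hi : R) : continuity (clip lo hi).
Proof.
  apply continuity_of_eps. intros x eps Heps. exists eps. split; auto.
  intros y Hy. eapply Rle_lt_trans; [|apply Hy].
  unfold clip, Rmax, Rmin. repeat destruct Rle_dec; split_Rabs; lra.
Qed.

Lemma sin_PI_eq_0 (x : R) : sin (PI * x) = 0 <-> exists z : Z, x = IZR z.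
Proof.
  pose proof PI_RGT_0. split.
  - intros H0. destruct (sin_eq_0_0 _ H0) as [z Hz]. exists z.
    apply Rmult_eq_reg_l with PI; lra.
  - intros [z ->]. apply sin_eq_0_1. exists z. ring.
Qed.

Lemma sin_PI_sqr_periodic (x : R) (z : Z) : sin (PI * (x + IZR z)) ^ 2 = sin (PI * x) ^ 2.
Proof.
  rewrite Rmult_plus_distr_l, sin_plus.
  assert (Hs : sin (PI * IZR z) = 0) by (apply sin_PI_eq_0; eauto).
  pose proof (sin2_cos2 (PI * IZR z)) as H. unfold Rsqr in H.
  rewrite Hs in *. rewrite Rmult_0_r, Rplus_0_r, Rpow_mult_distr.
  replace (cos (PI * IZR z) ^ 2) with 1 by nra. ring.
Qed.

Section Interpolation.

Variables theta v v' : nat -> R.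

(* When [theta i - theta j] is an integer this is [0], since [/ 0 = 0]. *)
Fixpoint bump (i : nat) (t : R) (n : nat) : R :=
  match n with
  | O => 1
  | S j => bump i t j *
     (sin (PI * (t - theta j)) ^ 2 / sin (PI * (theta i - theta j)) ^ 2)
  end.

(** A cutoff in [|t|] times a 1-periodic trigonometric Lagrange factor, which vanishes on the phases
    of all earlier nodes. *)
Definition weight (i : nat) (t : R) : R := clip 0 1 (Rabs t - INR i) * bump i t i.

Definition target (i : nat) (t : R) : R :=
  v i * clip 0 1 t + v' i * clip 0 1 (- t).

(** Interpolation in the style of Newton: stage [i] corrects the values on the phase of [theta i]
    without disturbing earlier phases, and changes nothing where [|t| <= i], so finitely many stages
    act on each bounded interval. *)
Fixpoint interp (n : nat) (t : R) : R :=
  match n with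
  | O => 0
  | S i => interp i t + (target i t - interp i t) * weight i t
  end.

Lemma continuity_id : continuity (fun t => t).
Proof. apply derivable_continuous, derivable_id. Qed.

Lemma continuity_cst (k : R) : continuity (fun _ => k).
Proof. intros t. apply continuity_pt_const. intros ? ?; reflexivity. Qed.

Lemma continuity_bump (i n : nat) : continuity (fun t => bump i t n).
Proof.
  induction n; simpl; [apply continuity_cst|].
  apply (continuity_mult _ _ IHn). unfold Rdiv.
  apply (continuity_mult (fun t => sin (PI * (t - theta n)) ^ 2)); [|apply continuity_cst].
  assert (Hs : continuity (fun t => sin (PI * (t - theta n)))).
  { apply (continuity_comp (fun t => PI * (t - theta n)) sin); [|apply continuity_sin].
    apply (continuity_mult (fun _ => PI)); [apply continuity_cst|].
    apply (continuity_minus (fun t => t)); [apply continuity_id|apply continuity_cst]. }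
  apply (continuity_mult _ _ Hs). apply (continuity_mult _ _ Hs). apply continuity_cst.
Qed.

Lemma continuity_interp (n : nat) : continuity (interp n).
Proof.
  induction n; [apply continuity_cst|].
  change (continuity (fun t => interp n t + (target n t - interp n t) * weight n t)).
  apply continuity_plus; auto. apply continuity_mult.
  - apply continuity_minus; auto.
    apply (continuity_plus (fun t => v n * clip 0 1 t) (fun t => v' n * clip 0 1 (- t)));
      apply continuity_mult; try apply continuity_cst.
    + apply continuity_clip.
    + apply (continuity_comp Ropp (clip 0 1)); [|apply continuity_clip].
      apply (continuity_opp _ continuity_id).
  - apply (continuity_mult (fun t => clip 0 1 (Rabs t - INR n)) (fun t => bump n t n)).
    + apply (continuity_comp (fun t => Rabs t - INR n) (clip 0 1)); [|apply continuity_clip].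
      apply (continuity_minus Rabs); [apply Rcontinuity_abs|apply continuity_cst].
    + apply continuity_bump.
Qed.

Lemma interp_stable (n m : nat) (t : R) : Rabs t <= INR n -> (n <= m)%nat ->
  interp m t = interp n t.
Proof.
  intros Ht Hm. induction Hm as [|m Hm IH]; auto.
  simpl. unfold weight. apply le_INR in Hm. rewrite clip_low by lra. lra.
Qed.

Lemma bump_0 (i j n : nat) (t : R) : (j < n)%nat -> (exists z, t - theta j = IZR z) ->
  bump i t n = 0.
Proof.
  intros Hj Hz. induction n; [lia|]. simpl.
  destruct (Nat.eq_dec j n) as [->|Hne].
  - apply sin_PI_eq_0 in Hz. rewrite Hz. unfold Rdiv. ring.
  - rewrite IHn by lia. ring.
Qed.

Lemma bump_1 (i n : nat) (t : R) : (exists z, t - theta i = IZR z) ->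
  (forall j, (j < n)%nat -> ~ exists z, theta i - theta j = IZR z) ->
  bump i t n = 1.
Proof.
  intros [z Hz] Hn. induction n; auto. simpl.
  rewrite IHn by (intros; apply Hn; lia).
  replace (t - theta n) with (theta i - theta n + IZR z) by lra.
  pose proof (sin_PI_sqr_periodic (theta i - theta n) z) as Hp. simpl in Hp. rewrite Hp.
  field. intros H. apply (Hn n); [lia|]. apply sin_PI_eq_0; auto.
Qed.

Hypothesis consistent : forall i j, (exists z, theta i - theta j = IZR z) ->
  v i = v j /\ v' i = v' j.

(** A phase already met is settled by the earlier node, with the same values by [consistent]. On a
    new phase stage [i] installs the target, and all later bumps vanish there. *)
Lemma interp_node (i m : nat) (t : R) : (exists z, t - theta i = IZR z) ->
  INR i + 1 <= Rabs t -> (i < m)%nat -> interp m t = target i t.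
Proof.
  revert m. induction i as [i IH] using lt_wf_ind. intros m Hz Ht Hm.
  destruct (classic (exists j, (j < i)%nat /\ exists z, theta i - theta j = IZR z))
    as [[j [Hj Hij]]|Hn].
  - rewrite (IH j Hj m); [| |apply lt_INR in Hj; lra|lia].
    + unfold target. destruct (consistent i j Hij) as [-> ->]. reflexivity.
    + destruct Hz as [z1 H1], Hij as [z2 H2]. exists (z1 + z2)%Z. rewrite plus_IZR. lra.
  - induction Hm as [|m Hm IHm].
    + simpl. unfold weight. rewrite clip_high by lra.
      rewrite bump_1; auto; [ring|]. intros j Hj Hzj. apply Hn. eauto.
    + simpl. rewrite IHm. unfold weight. rewrite (bump_0 m i m t); auto. ring.
Qed.

End Interpolation.

Lemma exists_interpolation (theta v v' : nat -> R) :
  (forall i, -1 <= v i <= 1) -> (forall i, -1 <= v' i <= 1) ->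
  (forall i j, (exists z, theta i - theta j = IZR z) -> v i = v j /\ v' i = v' j) ->
  exists c : R -> R, continuity c /\ (forall t, -1 <= c t <= 1) /\
    forall i, exists K : nat, forall k : nat, (k >= K)%nat ->
      c (theta i + INR k) = v i /\ c (theta i - INR k) = v' i.
Proof.
  intros Hv Hv' Hc.
  set (N := fun t => Z.to_nat (up (Rabs t))).
  assert (HN : forall t, Rabs t <= INR (N t)).
  { intros t. unfold N. destruct (archimed (Rabs t)) as [H _].
    pose proof (Rabs_pos t).
    rewrite INR_IZR_INZ, Z2Nat.id; [lra|]. apply le_IZR. lra. }
  (* The stages stabilize on bounded intervals, so [c] is locally a single clipped [interp m].
     Clipping does not affect the node values, which lie in [[-1, 1]]. *)
  set (c := fun t => clip (-1) 1 (interp theta v v' (N t) t)).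
  assert (Hcm : forall m t, Rabs t <= INR m -> c t = clip (-1) 1 (interp theta v v' m t)).
  { intros m t Hm. unfold c. f_equal.
    rewrite <- (interp_stable theta v v' (N t) (max m (N t))) by (auto; lia).
    apply interp_stable; auto; lia. }
  assert (Hnode : forall i t, (exists z, t - theta i = IZR z) -> INR i + 1 <= Rabs t ->
     c t = clip (-1) 1 (target v v' i t)).
  { intros i t Hz Ht. rewrite (Hcm (max (S i) (N t))).
    - f_equal. apply interp_node; auto. lia.
    - eapply Rle_trans; [apply HN|]. apply le_INR. lia. }
  exists c. split; [|split].
  - apply continuity_of_eps. intros t eps Heps.
    destruct (INR_unbounded (Rabs t + 1)) as [m Hm].
    destruct (eps_of_continuity (fun t => clip (-1) 1 (interp theta v v' m t)) t eps)
      as [delta [Hd Hdl]]; auto.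
    { apply (continuity_comp (interp theta v v' m) (clip (-1) 1)).
      apply continuity_interp. apply continuity_clip. }
    exists (Rmin 1 delta). split; [apply Rmin_glb_lt; lra|]. intros y Hy.
    pose proof (Rmin_l 1 delta). pose proof (Rmin_r 1 delta).
    rewrite (Hcm m y) by (split_Rabs; lra). rewrite (Hcm m t) by lra.
    apply Hdl. lra.
  - intros t. apply clip_bounds. lra.
  - intros i. destruct (INR_unbounded (INR i + 1 + Rabs (theta i) + 1)) as [K HK].
    pose proof (pos_INR i).
    exists K. intros k Hk. apply le_INR in Hk. split.
    + rewrite (Hnode i).
      * unfold target. rewrite (clip_high 0 1), (clip_low 0 1) by (split_Rabs; lra).
        rewrite Rmult_1_r, Rmult_0_r, Rplus_0_r. apply clip_id; auto.
      * exists (Z.of_nat k). rewrite <- INR_IZR_INZ. ring.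
      * split_Rabs; lra.
    + rewrite (Hnode i).
      * unfold target. rewrite (clip_low 0 1), (clip_high 0 1) by (split_Rabs; lra).
        rewrite Rmult_1_r, Rmult_0_r, Rplus_0_l. apply clip_id; auto.
      * exists (- Z.of_nat k)%Z. rewrite opp_IZR, <- INR_IZR_INZ. ring.
      * split_Rabs; lra.
Qed.

(** * The foliation between the two combs *)

Section Envelope.

Variables h b : nat -> R.

Definition below_cone (L r x : R) : Prop :=
  x <= 1 /\ forall n, x <= h n + L * Rabs (r - b n).

(** The infimum of [1] and of all cones of slope [L] with apex [(b n, h n)], encoded as the greatest
    common lower bound. *)
Definition env (L r : R) : R :=
  epsilon (inhabits 0) (fun u => below_cone L r u /\ forall x, below_cone L r x -> x <= u).

Hypothesis h_lo : forall n, -1 <= h n.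

Lemma env_spec (L r : R) : 0 <= L ->
  below_cone L r (env L r) /\ forall x, below_cone L r x -> x <= env L r.
Proof.
  intros HL. apply (epsilon_spec (inhabits 0)
    (fun u => below_cone L r u /\ forall x, below_cone L r x -> x <= u)).
  destruct (completeness (below_cone L r)) as [u [Hu1 Hu2]].
  - exists 1. intros x [Hx _]. exact Hx.
  - exists (-1). split; [lra|]. intros n. pose proof (h_lo n).
    pose proof (Rabs_pos (r - b n)). nra.
  - exists u. split; [split|exact Hu1].
    + apply Hu2. intros x [Hx _]. exact Hx.
    + intros n. apply Hu2. intros x [_ Hx]. apply Hx.
Qed.

Lemma env_le_1 (L r : R) : 0 <= L -> env L r <= 1.
Proof. intros HL. apply (proj1 (env_spec L r HL)). Qed.

Lemma env_le_cone (L r : R) (n : nat) : 0 <= L -> env L r <= h n + L * Rabs (r - b n).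
Proof. intros HL. apply (proj1 (env_spec L r HL)). Qed.

Lemma env_glb (L r x : R) : 0 <= L -> x <= 1 ->
  (forall n, x <= h n + L * Rabs (r - b n)) -> x <= env L r.
Proof. intros HL H1 H2. apply (proj2 (env_spec L r HL)). split; auto. Qed.

Lemma env_ge_m1 (L r : R) : 0 <= L -> -1 <= env L r.
Proof.
  intros HL. apply env_glb; auto; [lra|]. intros n. pose proof (h_lo n).
  pose proof (Rabs_pos (r - b n)). nra.
Qed.

Lemma env_mono (L L' r : R) : 0 <= L <= L' -> env L r <= env L' r.
Proof.
  intros HL. apply env_glb; [lra|apply env_le_1; lra|]. intros n.
  pose proof (env_le_cone L r n ltac:(lra)). pose proof (Rabs_pos (r - b n)). nra.
Qed.

Lemma env_lip (L r r' : R) : 0 <= L -> Rabs (env L r - env L r') <= L * Rabs (r - r').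
Proof.
  intros HL.
  assert (H : forall x y, env L x - env L y <= L * Rabs (x - y)).
  { intros x y.
    enough (env L x - L * Rabs (x - y) <= env L y) by lra.
    apply env_glb; auto.
    - pose proof (env_le_1 L x HL). pose proof (Rabs_pos (x - y)). nra.
    - intros n. pose proof (env_le_cone L x n HL).
      assert (Rabs (x - b n) <= Rabs (x - y) + Rabs (y - b n)) by (split_Rabs; lra).
      nra. }
  pose proof (H r r'). pose proof (H r' r) as H2. rewrite (Rabs_minus_sym r' r) in H2.
  apply Rabs_le. lra.
Qed.

(** Both [r] and [b n] lie in [[-1, 1]], so steepening lifts each cone by at most [2 * (L' - L)]. *)
Lemma env_lip_slope (L L' r : R) : 0 <= L <= L' -> -1 <= r <= 1 ->
  (forall n, -1 <= b n <= 1) -> env L' r <= env L r + 2 * (L' - L).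
Proof.
  intros HL Hr Hb. enough (env L' r - 2 * (L' - L) <= env L r) by lra.
  apply env_glb; [lra| |].
  - pose proof (env_le_1 L' r ltac:(lra)). lra.
  - intros n. pose proof (env_le_cone L' r n ltac:(lra)). specialize (Hb n).
    assert (Rabs (r - b n) <= 2) by (split_Rabs; lra).
    pose proof (Rabs_pos (r - b n)). nra.
Qed.

Hypothesis h_cv : Un_cv h 1.

(** As [h] tends to [1], only finitely many apexes lie below [x], and they keep a distance [2 * rho]
    from [r0]. Within [rho] of [r0], slope [2 / rho] lifts their cones by at least [2], hence above
    [x]. *)
Lemma env_lower (x r0 : R) : x < 1 -> (forall n, h n < x -> b n <> r0) ->
  exists L1 rho, 0 < rho /\ 0 <= L1 /\
    forall L r, L1 <= L -> Rabs (r - r0) < rho -> x <= env L r.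
Proof.
  intros Hx Hb.
  destruct (h_cv (1 - x) ltac:(lra)) as [N HN]. unfold Rdist in HN.
  assert (Hfin : exists rho, 0 < rho /\
     forall n, (n < N)%nat -> h n < x -> 2 * rho <= Rabs (b n - r0)).
  { clear HN. induction N as [|N [rho [Hrho IH]]].
    - exists 1. split; [lra|]. intros; lia.
    - destruct (Rlt_dec (h N) x) as [H|H].
      + assert (Hp : 0 < Rabs (b N - r0)) by (apply Rabs_pos_lt; specialize (Hb N H); lra).
        exists (Rmin rho (Rabs (b N - r0) / 2)). split; [apply Rmin_glb_lt; lra|].
        intros n Hn Hnx. destruct (Nat.eq_dec n N) as [->|Hne].
        * pose proof (Rmin_r rho (Rabs (b N - r0) / 2)). lra.
        * pose proof (IH n ltac:(lia) Hnx).
          pose proof (Rmin_l rho (Rabs (b N - r0) / 2)). lra.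
      + exists rho. split; auto. intros n Hn Hnx.
        destruct (Nat.eq_dec n N) as [->|Hne]; [lra|]. apply IH; auto. lia. }
  destruct Hfin as [rho [Hrho Hfin]].
  exists (2 / rho), rho. split; auto.
  assert (Hp : 0 < 2 / rho) by (apply Rdiv_lt_0_compat; lra).
  split; [lra|]. intros L r HL Hr.
  apply env_glb; [lra|lra|]. intros n. pose proof (Rabs_pos (r - b n)).
  destruct (Rlt_dec (h n) x) as [Hn|Hn]; [|nra].
  assert (HnN : (n < N)%nat).
  { destruct (le_lt_dec N n) as [H1|H1]; auto. specialize (HN n H1).
    split_Rabs; lra. }
  pose proof (Hfin n HnN Hn).
  assert (Hd : rho <= Rabs (r - b n)) by (split_Rabs; lra).
  assert (2 <= L * Rabs (r - b n)).
  { replace 2 with (2 / rho * rho) by (field; lra). apply Rmult_le_compat; lra. }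
  pose proof (h_lo n). lra.
Qed.

End Envelope.

Lemma cv_1_lower_bound (h : nat -> R) : (forall n, -1 < h n) -> Un_cv h 1 ->
  exists eta, 0 < eta <= 1 /\ forall n, -1 + 2 * eta <= h n.
Proof.
  intros Hh Hcv. destruct (Hcv 1 ltac:(lra)) as [N HN]. unfold Rdist in HN.
  assert (H : exists eta, 0 < eta <= 1 / 2 /\ forall n, (n < N)%nat -> -1 + 2 * eta <= h n).
  { clear HN. induction N as [|N [eta [Heta IH]]].
    - exists (1 / 2). split; [lra|]. intros; lia.
    - exists (Rmin eta ((h N + 1) / 2)). specialize (Hh N).
      pose proof (Rmin_l eta ((h N + 1) / 2)). pose proof (Rmin_r eta ((h N + 1) / 2)).
      split; [split; [apply Rmin_glb_lt|]; lra|].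
      intros n Hn. destruct (Nat.eq_dec n N) as [->|Hne]; [lra|].
      specialize (IH n ltac:(lia)). lra. }
  destruct H as [eta [Heta H]]. exists eta. split; [lra|]. intros n.
  destruct (le_lt_dec N n) as [H1|H1]; auto. specialize (HN n H1). split_Rabs; lra.
Qed.

(* Only finitely many pairs satisfy [h n + k m < eta]; for these the cones are
   kept apart by a large slope. *)
Lemma env_separated (h b k b' : nat -> R) :
  (forall n, -1 < h n) -> (forall n, -1 < k n) -> Un_cv h 1 -> Un_cv k 1 ->
  (forall n m, b n <> b' m) ->
  exists L0, 0 <= L0 /\ forall L L' r, L0 <= L -> L0 <= L' ->
    0 < env h b L r + env k b' L' r.
Proof.
  intros Hh Hk Hhcv Hkcv Hb.
  destruct (cv_1_lower_bound h Hh Hhcv) as [e1 [He1 Hh1]].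
  destruct (cv_1_lower_bound k Hk Hkcv) as [e2 [He2 Hk1]].
  set (eta := Rmin e1 e2).
  assert (Heta : 0 < eta /\ eta <= e1 /\ eta <= e2).
  { unfold eta. pose proof (Rmin_l e1 e2). pose proof (Rmin_r e1 e2).
    pose proof (Rmin_glb_lt e1 e2 0). lra. }
  destruct (Hhcv eta ltac:(lra)) as [N HN]. destruct (Hkcv eta ltac:(lra)) as [M HM].
  unfold Rdist in *.
  assert (Hfin : exists rho, 0 < rho /\
     forall n m, (n < N)%nat -> (m < M)%nat -> rho <= Rabs (b n - b' m)).
  { clear HN HM. induction N as [|N [rho [Hrho IH]]].
    - exists 1. split; [lra|]. intros; lia.
    - assert (Hrow : exists rho', 0 < rho' /\ forall m, (m < M)%nat -> rho' <= Rabs (b N - b' m)).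
      { clear IH. induction M as [|M [rho' [Hrho' IH']]].
        - exists 1. split; [lra|]. intros; lia.
        - assert (Hp : 0 < Rabs (b N - b' M)) by (apply Rabs_pos_lt; specialize (Hb N M); lra).
          exists (Rmin rho' (Rabs (b N - b' M))). split; [apply Rmin_glb_lt; lra|].
          pose proof (Rmin_l rho' (Rabs (b N - b' M))).
          pose proof (Rmin_r rho' (Rabs (b N - b' M))).
          intros m Hm. destruct (Nat.eq_dec m M) as [->|Hne]; [lra|].
          specialize (IH' m ltac:(lia)). lra. }
      destruct Hrow as [rho' [Hrho' Hrow]]. exists (Rmin rho rho').
      split; [apply Rmin_glb_lt; lra|].
      pose proof (Rmin_l rho rho'). pose proof (Rmin_r rho rho').
      intros n m Hn Hm. destruct (Nat.eq_dec n N) as [->|Hne].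
      + specialize (Hrow m Hm). lra.
      + specialize (IH n m ltac:(lia) Hm). lra. }
  destruct Hfin as [rho [Hrho Hfin]].
  (* For a critical pair the two cones rise together by at least [3], while [h n + k m > -2] and
     [eta <= 1]. In any other pair one height exceeds [1 - eta] and the other is at least
     [-1 + 2 * eta]. *)
  exists (3 / rho). assert (Hp : 0 < 3 / rho) by (apply Rdiv_lt_0_compat; lra).
  split; [lra|]. intros L L' r HL HL'.
  pose proof (env_mono h b (fun n => Rlt_le _ _ (Hh n)) (3 / rho) L r ltac:(lra)) as H1.
  pose proof (env_mono k b' (fun n => Rlt_le _ _ (Hk n)) (3 / rho) L' r ltac:(lra)) as H2.
  enough (eta - env h b (3 / rho) r <= env k b' (3 / rho) r) by lra.
  apply env_glb; [intros; left; auto|lra| |].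
  - enough (-1 + eta <= env h b (3 / rho) r) by lra.
    apply env_glb; [intros; left; auto|lra|lra|]. intros n.
    specialize (Hh1 n). pose proof (Rabs_pos (r - b n)). nra.
  - intros m.
    enough (eta - (k m + 3 / rho * Rabs (r - b' m)) <= env h b (3 / rho) r) by lra.
    pose proof (Rabs_pos (r - b' m)). pose proof (Hk1 m).
    apply env_glb; [intros; left; auto|lra|nra|].
    intros n. pose proof (Rabs_pos (r - b n)). pose proof (Hh1 n).
    destruct (le_lt_dec N n) as [Hn|Hn].
    { specialize (HN n Hn). assert (1 - eta < h n) by (split_Rabs; lra). nra. }
    destruct (le_lt_dec M m) as [Hm|Hm].
    { specialize (HM m Hm). assert (1 - eta < k m) by (split_Rabs; lra). nra. }
    pose proof (Hfin n m Hn Hm).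
    assert (rho <= Rabs (r - b n) + Rabs (r - b' m)) by (split_Rabs; lra).
    assert (3 <= 3 / rho * (Rabs (r - b n) + Rabs (r - b' m))).
    { replace 3 with (3 / rho * rho) at 1 by (field; lra).
      apply Rmult_le_compat_l; lra. }
    lra.
Qed.

(** * Slopes, weights and leaves as functions of time *)

Definition slope (t : R) : R := sqrt (sqrt (1 + Rmax t 0)).

Lemma slope_neg (t : R) : t <= 0 -> slope t = 1.
Proof. intros H. unfold slope. rewrite Rmax_right, Rplus_0_r, !sqrt_1; auto. Qed.

Lemma slope_sqr (t : R) : 0 <= t -> slope t * slope t = sqrt (1 + t).
Proof.
  intros H. unfold slope. rewrite Rmax_left by lra. apply sqrt_sqrt, sqrt_pos.
Qed.

Lemma slope_mono (t t' : R) : t <= t' -> slope t <= slope t'.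
Proof.
  intros H. unfold slope. apply sqrt_le_1_alt, sqrt_le_1_alt.
  unfold Rmax. repeat destruct Rle_dec; lra.
Qed.

Lemma slope_ge_1 (t : R) : 1 <= slope t.
Proof.
  destruct (Rle_dec t 0) as [H|H].
  - rewrite slope_neg; lra.
  - rewrite <- (slope_neg 0) by lra. apply slope_mono. lra.
Qed.

(** With [y ^ 4 = 1 + t] and [z ^ 4 = 1 + t'], the difference [t' - t] is [z - y] times
    [(z + y) * (z ^ 2 + y ^ 2)], which is at least [slope T]. This decay of the increments is what
    slows the leaves down. *)
Lemma slope_diff (T t t' : R) : 0 <= T <= t -> t <= t' ->
  slope t' - slope t <= (t' - t) / slope T.
Proof.
  intros HT Ht.
  pose proof (slope_mono T t ltac:(lra)). pose proof (slope_mono t t' Ht).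
  pose proof (slope_ge_1 T).
  pose proof (slope_sqr t ltac:(lra)) as Hy2. pose proof (slope_sqr t' ltac:(lra)) as Hz2.
  pose proof (sqrt_sqrt (1 + t) ltac:(lra)) as Hy4.
  pose proof (sqrt_sqrt (1 + t') ltac:(lra)) as Hz4.
  rewrite <- Hy2 in Hy4. rewrite <- Hz2 in Hz4.
  set (x := slope T) in *. set (y := slope t) in *. set (z := slope t') in *.
  assert (Hd : (z - y) * ((z + y) * (z * z + y * y)) = t' - t) by nra.
  apply Rmult_le_reg_r with x; [lra|].
  replace ((t' - t) / x * x) with (t' - t) by (field; lra).
  rewrite <- Hd. apply Rmult_le_compat_l; [lra|]. nra.
Qed.

Lemma slope_lip (t t' : R) : t <= t' -> slope t' - slope t <= t' - t.
Proof.
  intros Ht.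
  assert (Hm : forall u, slope u = slope (Rmax u 0)).
  { intros u. unfold slope. rewrite (Rmax_left (Rmax u 0)); auto. apply Rmax_r. }
  rewrite (Hm t), (Hm t').
  assert (H0 : 0 <= Rmax t 0) by apply Rmax_r.
  assert (Hd : Rmax t 0 <= Rmax t' 0 /\ Rmax t' 0 - Rmax t 0 <= t' - t)
    by (unfold Rmax; repeat destruct Rle_dec; lra).
  pose proof (slope_diff 0 (Rmax t 0) (Rmax t' 0) ltac:(lra) (proj1 Hd)) as H.
  rewrite (slope_neg 0) in H by lra. lra.
Qed.

Lemma slope_unbounded (A : R) : exists T0, 0 <= T0 /\ forall t, T0 <= t -> A < slope t.
Proof.
  set (B := Rabs A + 1). pose proof (Rle_abs A). pose proof (Rabs_pos A).
  exists (B * B * (B * B)). split; [unfold B; nra|]. intros t Ht.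
  apply Rlt_le_trans with B; [unfold B; lra|].
  unfold slope. rewrite Rmax_left by (unfold B in *; nra).
  assert (HB : 1 <= B) by (unfold B; lra).
  rewrite <- (sqrt_square B) by lra. apply sqrt_le_1_alt.
  rewrite <- (sqrt_square (B * B)) by nra. apply sqrt_le_1_alt. lra.
Qed.

(** A sigmoid with [ratio t + ratio (- t) = 1], used as the weight of a convex combination. Its
    strict growth makes the leaves strictly increasing in time. *)
Definition ratio (t : R) : R := (1 + t / (1 + Rabs t)) / 2.

Lemma ratio_opp (t : R) : ratio (- t) = 1 - ratio t.
Proof. unfold ratio. rewrite Rabs_Ropp. pose proof (Rabs_pos t). field. lra. Qed.

Lemma ratio_nonneg (t : R) : 0 <= t -> 1 - ratio t = / (2 * (1 + t)).
Proof. intros H. unfold ratio. rewrite Rabs_pos_eq by auto. field. lra. Qed.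

Lemma ratio_lt_1 (t : R) : ratio t < 1.
Proof.
  destruct (Rle_dec 0 t) as [H|H].
  - pose proof (ratio_nonneg t H).
    pose proof (Rinv_0_lt_compat (2 * (1 + t)) ltac:(lra)). lra.
  - unfold ratio. assert (t / (1 + Rabs t) < 0); [|lra].
    pose proof (Rabs_pos t). unfold Rdiv.
    pose proof (Rinv_0_lt_compat (1 + Rabs t) ltac:(lra)). nra.
Qed.

Lemma ratio_pos (t : R) : 0 < ratio t.
Proof. pose proof (ratio_lt_1 (- t)) as H. rewrite ratio_opp in H. lra. Qed.

Lemma ratio_diff (T t t' : R) : 0 <= T <= t -> t < t' ->
  0 < ratio t' - ratio t <= (t' - t) / (1 + T).
Proof.
  intros HT Ht. pose proof (ratio_nonneg t ltac:(lra)) as H1.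
  pose proof (ratio_nonneg t' ltac:(lra)) as H2.
  assert (He : ratio t' - ratio t = (t' - t) / ((1 + t') * (2 * (1 + t)))).
  { replace (ratio t' - ratio t) with (1 - ratio t - (1 - ratio t')) by ring.
    rewrite H1, H2. field. lra. }
  rewrite He. split.
  - apply Rdiv_lt_0_compat; nra.
  - apply Rmult_le_compat_l; [lra|]. apply Rinv_le_contravar; nra.
Qed.

Lemma ratio_lip (t t' : R) : t < t' -> 0 < ratio t' - ratio t <= t' - t.
Proof.
  assert (Hp : forall u u', 0 <= u < u' -> 0 < ratio u' - ratio u <= u' - u).
  { intros u u' Hu. pose proof (ratio_diff 0 u u' ltac:(lra) ltac:(lra)) as H.
    rewrite Rplus_0_r, Rdiv_1_r in H. exact H. }
  assert (Hn : forall u u', u < u' <= 0 -> 0 < ratio u' - ratio u <= u' - u).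
  { intros u u' Hu. pose proof (Hp (- u') (- u) ltac:(lra)) as H.
    rewrite !ratio_opp in H. lra. }
  intros Ht. destruct (Rle_dec 0 t) as [H|H]; [apply Hp; lra|].
  destruct (Rle_dec t' 0) as [H'|H']; [apply Hn; lra|].
  pose proof (Hp 0 t' ltac:(lra)). pose proof (Hn t 0 ltac:(lra)). lra.
Qed.

(** A convex combination of the upper envelope and the negated lower one. The lower comb enters
    through negated heights [k], so exchanging the combs amounts to reversing time and sign, and
    each end of time is treated like the other. [L0] is meant as a slope from which the two
    envelopes stay apart. *)
Definition leaf0 (h b k b' : nat -> R) (L0 t r : R) : R :=
  ratio t * env h b (L0 + slope t) r - ratio (- t) * env k b' (L0 + slope (- t)) r.

Lemma leaf0_opp (h b k b' : nat -> R) (L0 t r : R) :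
  leaf0 h b k b' L0 (- t) r = - leaf0 k b' h b L0 t r.
Proof. unfold leaf0. rewrite Ropp_involutive. ring. Qed.

Section Leaves.

Variables (h b k b' : nat -> R) (L0 : R).
Hypothesis h_lo : forall n, -1 < h n <= 1.
Hypothesis k_lo : forall n, -1 < k n <= 1.
Hypothesis b_int : forall n, -1 <= b n <= 1.
Hypothesis b'_int : forall n, -1 <= b' n <= 1.
Hypothesis L0_pos : 0 <= L0.
Hypothesis separated : forall L L' r, L0 <= L -> L0 <= L' ->
  0 < env h b L r + env k b' L' r.

Let h_lo' n : -1 <= h n := Rlt_le _ _ (proj1 (h_lo n)).
Let k_lo' n : -1 <= k n := Rlt_le _ _ (proj1 (k_lo n)).

Local Notation leaf_ := (leaf0 h b k b' L0).

Lemma leaf0_bounds (t r : R) : -1 <= leaf_ t r <= 1.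
Proof.
  unfold leaf0. rewrite ratio_opp.
  pose proof (ratio_lt_1 t). pose proof (ratio_pos t).
  pose proof (slope_ge_1 t). pose proof (slope_ge_1 (- t)).
  pose proof (env_le_1 h b h_lo' (L0 + slope t) r ltac:(lra)).
  pose proof (env_ge_m1 h b h_lo' (L0 + slope t) r ltac:(lra)).
  pose proof (env_le_1 k b' k_lo' (L0 + slope (- t)) r ltac:(lra)).
  pose proof (env_ge_m1 k b' k_lo' (L0 + slope (- t)) r ltac:(lra)). nra.
Qed.

(** The increment is [u' * (A' - A) + (1 - u') * (B - B') + (u' - u) * (A + B)]: envelopes grow with
    their slopes, and the last term is positive by [separated]. *)
Lemma leaf0_increasing (t t' r : R) : t < t' -> leaf_ t r < leaf_ t' r.
Proof.
  intros Ht. unfold leaf0. rewrite !ratio_opp.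
  pose proof (ratio_lip t t' Ht) as Hr.
  pose proof (ratio_lt_1 t'). pose proof (ratio_pos t).
  pose proof (slope_ge_1 t). pose proof (slope_ge_1 (- t')).
  pose proof (slope_mono t t' ltac:(lra)).
  pose proof (slope_mono (- t') (- t) ltac:(lra)).
  pose proof (env_mono h b h_lo' (L0 + slope t) (L0 + slope t') r ltac:(lra)) as E1.
  pose proof (env_mono k b' k_lo' (L0 + slope (- t')) (L0 + slope (- t)) r ltac:(lra)) as E2.
  pose proof (separated (L0 + slope t) (L0 + slope (- t)) r ltac:(lra) ltac:(lra)) as E3.
  set (A := env h b (L0 + slope t) r) in *. set (A' := env h b (L0 + slope t') r) in *.
  set (B := env k b' (L0 + slope (- t)) r) in *.
  set (B' := env k b' (L0 + slope (- t')) r) in *.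
  set (u := ratio t) in *. set (u' := ratio t') in *.
  assert (u' * A <= u' * A') by nra.
  assert ((1 - u') * B' <= (1 - u') * B) by nra.
  assert (0 < (u' - u) * (A + B)) by nra. nra.
Qed.

(** The same three terms as in [leaf0_increasing], now bounded above one by one. *)
Lemma leaf0_diff (t t' e1 e2 e3 r : R) : t < t' -> -1 <= r <= 1 ->
  ratio t' - ratio t <= e1 -> slope t' - slope t <= e2 ->
  slope (- t) - slope (- t') <= e3 ->
  leaf_ t' r - leaf_ t r <= 2 * (e1 + e2 + e3).
Proof.
  intros Ht Hr E1 E2 E3. unfold leaf0. rewrite !ratio_opp.
  pose proof (ratio_lip t t' Ht).
  pose proof (ratio_lt_1 t). pose proof (ratio_pos t').
  pose proof (ratio_pos t). pose proof (ratio_lt_1 t').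
  pose proof (slope_ge_1 t). pose proof (slope_ge_1 (- t')).
  pose proof (slope_mono t t' ltac:(lra)).
  pose proof (slope_mono (- t') (- t) ltac:(lra)).
  pose proof (env_lip_slope h b h_lo' (L0 + slope t) (L0 + slope t') r ltac:(lra) Hr b_int) as E4.
  pose proof (env_lip_slope k b' k_lo' (L0 + slope (- t')) (L0 + slope (- t)) r
    ltac:(lra) Hr b'_int) as E5.
  pose proof (env_le_1 h b h_lo' (L0 + slope t) r ltac:(lra)).
  pose proof (env_le_1 k b' k_lo' (L0 + slope (- t)) r ltac:(lra)).
  set (A := env h b (L0 + slope t) r) in *. set (A' := env h b (L0 + slope t') r) in *.
  set (B := env k b' (L0 + slope (- t)) r) in *.
  set (B' := env k b' (L0 + slope (- t')) r) in *.
  set (u := ratio t) in *. set (u' := ratio t') in *.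
  assert (u' * (A' - A) <= 2 * e2).
  { assert (u' * (A' - A) <= u' * (2 * e2)) by (apply Rmult_le_compat_l; lra). nra. }
  assert ((1 - u') * (B - B') <= 2 * e3).
  { assert ((1 - u') * (B - B') <= (1 - u') * (2 * e3)) by (apply Rmult_le_compat_l; lra). nra. }
  assert ((u' - u) * (A + B) <= 2 * e1).
  { apply Rle_trans with ((u' - u) * 2); [apply Rmult_le_compat_l|]; lra. }
  nra.
Qed.

Lemma leaf0_lip_time (t t' r : R) : -1 <= r <= 1 ->
  Rabs (leaf_ t r - leaf_ t' r) <= 6 * Rabs (t - t').
Proof.
  intros Hr.
  assert (H : forall u u', u < u' -> leaf_ u' r - leaf_ u r <= 6 * (u' - u)).
  { intros u u' Hu.
    pose proof (leaf0_diff u u' (u' - u) (u' - u) (u' - u) r Hu Hr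
      (proj2 (ratio_lip u u' Hu)) (slope_lip u u' (Rlt_le _ _ Hu))) as H.
    pose proof (slope_lip (- u') (- u) ltac:(lra)). lra. }
  destruct (Rtotal_order t t') as [Ht|[->|Ht]].
  - pose proof (H t t' Ht). pose proof (leaf0_increasing t t' r Ht). split_Rabs; lra.
  - rewrite !Rminus_diag, Rabs_R0. lra.
  - pose proof (H t' t Ht). pose proof (leaf0_increasing t' t r Ht). split_Rabs; lra.
Qed.

(** At positive times the lower slope is frozen at [1], so only two terms remain, each at most the
    elapsed time over [slope T]. *)
Lemma leaf0_slow (T t t' r : R) : 0 <= T -> T <= t -> T <= t' -> -1 <= r <= 1 ->
  Rabs (leaf_ t r - leaf_ t' r) <= 4 * Rabs (t - t') / slope T.
Proof.
  intros HT Ht Ht' Hr.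
  assert (HgT : slope T <= 1 + T).
  { pose proof (slope_lip 0 T HT) as H. rewrite (slope_neg 0) in H; lra. }
  pose proof (slope_ge_1 T) as Hg1.
  assert (H : forall u u', T <= u -> u < u' -> leaf_ u' r - leaf_ u r <= 4 * (u' - u) / slope T).
  { intros u u' HTu Hu.
    assert (H1 : ratio u' - ratio u <= (u' - u) / slope T).
    { eapply Rle_trans; [apply (ratio_diff T); lra|].
      apply Rmult_le_compat_l; [lra|]. apply Rinv_le_contravar; lra. }
    pose proof (leaf0_diff u u' _ _ 0 r Hu Hr H1 (slope_diff T u u' ltac:(lra) ltac:(lra))) as H.
    rewrite !(slope_neg (- _)) in H by lra. specialize (H ltac:(lra)). lra. }
  destruct (Rtotal_order t t') as [Htt|[->|Htt]].
  - pose proof (H t t' Ht Htt). pose proof (leaf0_increasing t t' r Htt).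
    rewrite (Rabs_minus_sym t t'), (Rabs_pos_eq (t' - t)) by lra. split_Rabs; lra.
  - rewrite !Rminus_diag, Rabs_R0. lra.
  - pose proof (H t' t Ht' Htt). pose proof (leaf0_increasing t' t r Htt).
    rewrite (Rabs_pos_eq (t - t')) by lra. split_Rabs; lra.
Qed.

Lemma leaf0_lip (t r r' : R) :
  Rabs (leaf_ t r - leaf_ t r') <= (L0 + slope (Rabs t)) * Rabs (r - r').
Proof.
  unfold leaf0. rewrite !ratio_opp.
  pose proof (ratio_lt_1 t). pose proof (ratio_pos t).
  pose proof (slope_ge_1 t). pose proof (slope_ge_1 (- t)).
  pose proof (env_lip h b h_lo' (L0 + slope t) r r' ltac:(lra)) as E1.
  pose proof (env_lip k b' k_lo' (L0 + slope (- t)) r r' ltac:(lra)) as E2.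
  pose proof (slope_mono t (Rabs t) (Rle_abs t)).
  pose proof (slope_mono (- t) (Rabs t) ltac:(rewrite <- Rabs_Ropp; apply Rle_abs)).
  set (A := env h b (L0 + slope t) r) in *. set (A' := env h b (L0 + slope t) r') in *.
  set (B := env k b' (L0 + slope (- t)) r) in *.
  set (B' := env k b' (L0 + slope (- t)) r') in *.
  set (u := ratio t) in *. set (G := L0 + slope (Rabs t)) in *.
  pose proof (Rabs_pos (r - r')) as Hp. set (D := Rabs (r - r')) in *.
  assert (F1 : Rabs (A - A') <= G * D).
  { eapply Rle_trans; [apply E1|]. apply Rmult_le_compat_r; unfold G; lra. }
  assert (F2 : Rabs (B - B') <= G * D).
  { eapply Rle_trans; [apply E2|]. apply Rmult_le_compat_r; unfold G; lra. }
  replace (u * A - (1 - u) * B - (u * A' - (1 - u) * B'))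
    with (u * (A - A') + (1 - u) * (B' - B)) by ring.
  eapply Rle_trans; [apply Rabs_triang|]. rewrite !Rabs_mult, (Rabs_minus_sym B' B).
  rewrite (Rabs_pos_eq u), (Rabs_pos_eq (1 - u)) by lra. nra.
Qed.

(** [sqrt (1 + T)] is [slope T] squared, so a horizontal step of order [1 / slope ^ 2] on a leaf of
    slope [L0 + slope] changes the height by [O(1 / slope)], as does a bounded change of time. The
    margin [2] covers one unit of time and a slant of at most [1]. *)
Lemma leaf0_displacement (eta : R) : eta > 0 ->
  exists T0, 2 <= T0 /\ forall T u u' r r', T0 <= T ->
    T - 2 <= u <= T + 2 -> T - 2 <= u' <= T + 2 -> -1 <= r <= 1 ->
    Rabs (r' - r) * (4 * sqrt (1 + T)) <= 1 ->
    Rabs (leaf_ u' r' - leaf_ u r) < eta.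
Proof.
  (* [20] exceeds [16 + 3]: [16] from a change of time by at most [4], [L0 + 3] from the change of
     abscissa. *)
  intros Heta. destruct (slope_unbounded ((L0 + 20) / eta)) as [T1 [HT1 Hs]].
  exists (T1 + 2). split; [lra|]. intros T u u' r r' HT Hu Hu' Hr Hd.
  assert (Hu1 : Rabs (leaf_ u' r - leaf_ u r) <= 16 / slope (T - 2)).
  { eapply Rle_trans; [apply (leaf0_slow (T - 2)); lra|].
    pose proof (slope_ge_1 (T - 2)). apply Rmult_le_compat_r.
    - left. apply Rinv_0_lt_compat. lra.
    - assert (Rabs (u' - u) <= 4) by (split_Rabs; lra). lra. }
  assert (Hu2 : Rabs (leaf_ u' r' - leaf_ u' r) <= (L0 + 3) / slope (T - 2)).
  { eapply Rle_trans; [apply leaf0_lip|].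
    rewrite (Rabs_pos_eq u') by lra.
    rewrite <- slope_sqr in Hd by lra.
    pose proof (slope_mono u' (T + 2) ltac:(lra)).
    pose proof (slope_lip T (T + 2) ltac:(lra)).
    pose proof (slope_mono (T - 2) T ltac:(lra)).
    pose proof (slope_ge_1 (T - 2)). pose proof (slope_ge_1 u').
    pose proof (Rabs_pos (r' - r)) as HD.
    set (D := Rabs (r' - r)) in *. set (x := slope (T - 2)) in *. set (y := slope T) in *.
    apply Rmult_le_reg_r with x; [lra|].
    replace ((L0 + 3) / x * x) with (L0 + 3) by (field; lra).
    assert (Hxy : D * (x * y) <= 1).
    { eapply Rle_trans; [|apply Hd]. apply Rmult_le_compat_l; nra. }
    assert (HDx : D * x <= 1) by nra.
    assert (HDx0 : 0 <= D * x) by nra.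
    assert ((L0 + slope u') * (D * x) <= (L0 + (y + 2)) * (D * x)) by nra. nra. }
  pose proof (Hs (T - 2) ltac:(lra)) as HsT. pose proof (slope_ge_1 (T - 2)).
  assert (Hlt : (L0 + 20) / slope (T - 2) < eta).
  { apply Rmult_lt_reg_r with (slope (T - 2)); [lra|].
    replace ((L0 + 20) / slope (T - 2) * slope (T - 2)) with (L0 + 20) by (field; lra).
    replace (L0 + 20) with ((L0 + 20) / eta * eta) by (field; lra).
    rewrite (Rmult_comm eta). apply Rmult_lt_compat_r; lra. }
  assert (He : (L0 + 3) / slope (T - 2) + 16 / slope (T - 2) <= (L0 + 20) / slope (T - 2)).
  { pose proof (Rinv_0_lt_compat (slope (T - 2)) ltac:(lra)). unfold Rdiv. nra. }
  replace (leaf_ u' r' - leaf_ u r) with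
    ((leaf_ u' r' - leaf_ u' r) + (leaf_ u' r - leaf_ u r)) by ring.
  eapply Rle_lt_trans; [apply Rabs_triang|]. lra.
Qed.

Hypothesis h_cv : Un_cv h 1.

Lemma leaf0_le_env (t r : R) : leaf_ t r <= env h b (L0 + slope t) r.
Proof.
  unfold leaf0. rewrite ratio_opp.
  pose proof (ratio_lt_1 t).
  pose proof (slope_ge_1 t). pose proof (slope_ge_1 (- t)).
  pose proof (separated (L0 + slope t) (L0 + slope (- t)) r ltac:(lra) ltac:(lra)). nra.
Qed.

Lemma leaf0_lower (x r0 eta : R) : x < 1 -> (forall n, h n < x -> b n <> r0) -> eta > 0 ->
  exists T0 rho, 0 < rho /\
    forall t r, T0 <= t -> Rabs (r - r0) < rho -> x - eta < leaf_ t r.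
Proof.
  intros Hx Hb Heta.
  destruct (env_lower h b h_lo' h_cv x r0 Hx Hb) as (L1 & rho & Hrho & HL1 & H).
  destruct (slope_unbounded L1) as [T1 [HT1 Hs]].
  (* From time [/ eta] on, the weight of the lower envelope is below [eta / 2]; as both envelopes
     are at most [1], it costs less than [eta]. *)
  destruct (INR_unbounded (/ eta)) as [n Hn].
  exists (Rmax T1 (INR n)), rho. split; auto. intros t r Ht Hr.
  pose proof (Rmax_l T1 (INR n)). pose proof (Rmax_r T1 (INR n)). pose proof (pos_INR n).
  specialize (H (L0 + slope t) r ltac:(pose proof (Hs t); lra) Hr).
  unfold leaf0. rewrite ratio_opp, ratio_nonneg by lra.
  pose proof (ratio_pos t). pose proof (ratio_nonneg t ltac:(lra)).
  pose proof (slope_ge_1 (- t)).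
  pose proof (env_le_1 k b' k_lo' (L0 + slope (- t)) r ltac:(lra)).
  assert (Hi : / (2 * (1 + t)) < eta / 2).
  { pose proof (Rinv_0_lt_compat eta Heta). rewrite Rinv_mult.
    assert (/ (1 + t) < eta); [|lra].
    rewrite <- (Rinv_inv eta). apply Rinv_lt_contravar; nra. }
  pose proof (Rinv_0_lt_compat (2 * (1 + t)) ltac:(lra)).
  set (w := / (2 * (1 + t))) in *. replace (ratio t) with (1 - w) in * by lra.
  assert ((1 - w) * x <= (1 - w) * env h b (L0 + slope t) r) by (apply Rmult_le_compat_l; lra).
  assert (w * env k b' (L0 + slope (- t)) r <= w * 1) by (apply Rmult_le_compat_l; lra).
  nra.
Qed.

Hypothesis h_lt : forall n, h n < 1.
Hypothesis b_inj : forall n m, b n = b m -> n = m.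

(** A squeeze. From below, distinct abscissas keep every tooth ending lower than [h n] away from
    [b n], so [leaf0_lower] applies; from above, the cone at the end of tooth [n] bounds the leaf,
    and the rate of approach beats its slope. *)
Lemma leaf0_cv (n : nat) (C M : R) (K : nat) (t r : nat -> R) : 1 <= M ->
  (forall j, (j >= K)%nat -> Rabs (r j - b n) * (INR j + M) <= C) ->
  (forall j, (j >= K)%nat -> t j <= INR j + M - 1) -> cv_infty t ->
  forall eps, eps > 0 -> exists N, forall j, (j >= N)%nat ->
    Rabs (leaf_ (t j) (r j) - h n) < eps /\ Rabs (r j - b n) < eps.
Proof.
  intros HM Hr Ht Hinf eps Heps.
  destruct (leaf0_lower (h n) (b n) eps (h_lt n)) as (T0 & rho & Hrho & Hlow); auto.
  { intros m Hm He. apply b_inj in He. subst m. lra. }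
  assert (HC : 0 <= C).
  { pose proof (Hr K (le_n K)). pose proof (Rabs_pos (r K - b n)). pose proof (pos_INR K). nra. }
  destruct (Hinf (Rmax T0 0)) as [N1 HN1].
  destruct (INR_unbounded (C / Rmin rho eps)) as [N2 HN2].
  destruct (slope_unbounded (C * (L0 + 1) / eps)) as [T3 [HT3 HN3]].
  destruct (INR_unbounded T3) as [N3 HN3'].
  assert (Hre : 0 < Rmin rho eps) by (apply Rmin_glb_lt; lra).
  exists (max K (max N1 (max N2 N3))). intros j Hj.
  specialize (Hr j ltac:(lia)). specialize (Ht j ltac:(lia)).
  specialize (HN1 j ltac:(lia)).
  assert (Hj2 : INR N2 <= INR j) by (apply le_INR; lia).
  assert (Hj3 : INR N3 <= INR j) by (apply le_INR; lia).
  pose proof (pos_INR j). pose proof (Rabs_pos (r j - b n)) as Hp.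
  set (D := Rabs (r j - b n)) in *.
  assert (HD : D < Rmin rho eps).
  { apply Rmult_lt_reg_r with (INR j + M); [lra|].
    eapply Rle_lt_trans; [apply Hr|].
    replace C with (C / Rmin rho eps * Rmin rho eps) at 1 by (field; lra).
    rewrite (Rmult_comm (Rmin rho eps)). apply Rmult_lt_compat_r; lra. }
  pose proof (Rmin_l rho eps). pose proof (Rmin_r rho eps).
  pose proof (Rmax_l T0 0). pose proof (Rmax_r T0 0).
  split; [|lra].
  specialize (Hlow (t j) (r j) ltac:(lra) ltac:(unfold D in *; lra)).
  pose proof (slope_ge_1 (t j)) as Hg1.
  pose proof (leaf0_le_env (t j) (r j)) as Hup.
  pose proof (env_le_cone h b h_lo' (L0 + slope (t j)) (r j) n ltac:(lra)) as Hcone.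
  (* With [x = (j + M) ^ (1/4)] the rate reads [D * x ^ 4 <= C], so [(L0 + x) * D] is at most
     [C * (L0 + 1) / x]. *)
  assert (HgD : (L0 + slope (t j)) * D < eps).
  { pose proof (slope_mono (t j) (INR j + M - 1) Ht) as Hg2.
    pose proof (slope_mono (INR j) (INR j + M - 1) ltac:(lra)) as Hg4.
    pose proof (HN3 (INR j) ltac:(lra)) as Hg3.
    pose proof (slope_sqr (INR j + M - 1) ltac:(lra)) as Hsq.
    replace (1 + (INR j + M - 1)) with (INR j + M) in Hsq by ring.
    pose proof (sqrt_sqrt (INR j + M) ltac:(lra)) as Hs.
    set (x := slope (INR j + M - 1)) in *. set (y := slope (INR j)) in *.
    rewrite <- Hsq in Hs. rewrite <- Hs in Hr.
    assert (Hx1 : 1 <= x) by apply slope_ge_1.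
    apply Rle_lt_trans with ((L0 + x) * D); [apply Rmult_le_compat_r; lra|].
    assert (Hx2 : C * (L0 + 1) < x * eps).
    { replace (C * (L0 + 1)) with (C * (L0 + 1) / eps * eps) by (field; lra).
      apply Rmult_lt_compat_r; lra. }
    assert (Hxx : D * x * x <= C).
    { eapply Rle_trans; [|apply Hr]. assert (0 <= D * x * x) by nra.
      replace (D * (x * x * (x * x))) with (D * x * x * (x * x)) by ring. nra. }
    apply Rmult_lt_reg_r with x; [lra|].
    apply Rle_lt_trans with (C * (L0 + 1)); [|lra].
    apply Rle_trans with ((L0 + 1) * (D * x * x)); [|nra].
    replace ((L0 + 1) * (D * x * x)) with ((L0 * x + x) * (D * x)) by ring.
    replace ((L0 + x) * D * x) with ((L0 + x) * (D * x)) by ring.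
    apply Rmult_le_compat_r; nra. }
  unfold D in *. split_Rabs; lra.
Qed.

(** Together with [leaf0_opp], this places a point of the open square whose abscissa carries no
    tooth between two leaves, ready for the intermediate value theorem. *)
Lemma leaf0_top (r eps : R) : (forall n, b n <> r) -> eps > 0 ->
  exists t, 1 - eps < leaf_ t r.
Proof.
  intros Hb Heps.
  destruct (leaf0_lower (1 - eps / 2) r (eps / 2)) as (T0 & rho & Hrho & H); auto; try lra.
  exists T0. replace (1 - eps) with (1 - eps / 2 - eps / 2) by field.
  apply H; [lra|]. rewrite Rminus_diag, Rabs_R0. lra.
Qed.

End Leaves.

(** * Homeomorphisms along a foliation *)

Definition jointly_continuous (G : R -> R -> R) : Prop :=
  forall t0 r0, -1 <= r0 <= 1 -> forall eps, eps > 0 -> exists delta, delta > 0 /\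
    forall t r, -1 <= r <= 1 -> Rabs (t - t0) < delta -> Rabs (r - r0) < delta ->
      Rabs (G t r - G t0 r0) < eps.

Definition in_strip (lev : R -> R -> R) (z : pt) : Prop := exists t, lev t (fst z) = snd z.

(** The time step [e] is a parameter so that the same results serve the map, with [1], and its
    inverse, with [-1]. *)
Definition strip_map (lev F : R -> R -> R) (e : R) (psi : pt -> pt) : Prop :=
  (forall t r, -1 <= r <= 1 -> psi (r, lev t r) = (F t r, lev (t + e) (F t r))) /\
  (forall z, closed_sq z -> ~ in_strip lev z -> psi z = z).

Record foliation (lev : R -> R -> R) : Prop := {
  fol_bounds : forall t r, -1 <= r <= 1 -> -1 <= lev t r <= 1;
  fol_increasing : forall t t' r, -1 <= r <= 1 -> t < t' -> lev t r < lev t' r;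
  fol_continuous : jointly_continuous lev }.

Lemma time_window (t T : R) : exists a : nat, forall i : nat,
  Rabs (t + INR i) < T -> (a <= i < a + Z.to_nat (up (2 * T)) + 1)%nat.
Proof.
  exists (Z.to_nat (up (- T - t))). intros i Hi.
  destruct (archimed (- T - t)) as [H1 H2]. destruct (archimed (2 * T)) as [H3 H4].
  apply Rabs_def2 in Hi. pose proof (pos_INR i) as Hi0. rewrite INR_IZR_INZ in *.
  assert (Ha : (up (- T - t) < Z.of_nat i + 1)%Z).
  { apply lt_IZR. rewrite plus_IZR. lra. }
  assert (Hb : (Z.of_nat i < up (- T - t) + up (2 * T))%Z).
  { apply lt_IZR. rewrite plus_IZR. lra. }
  assert (Hc : (0 < up (2 * T))%Z) by (apply lt_IZR; lra).
  lia.
Qed.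

Section Strip.

Variable lev : R -> R -> R.
Hypothesis lev_fol : foliation lev.

Lemma fol_time_unique (t t' r : R) : -1 <= r <= 1 -> lev t r = lev t' r -> t = t'.
Proof.
  intros Hr He. destruct (Rtotal_order t t') as [H|[H|H]]; auto;
    apply (fol_increasing lev lev_fol _ _ r Hr) in H; lra.
Qed.

Lemma fol_IVT (t1 t2 r s : R) : -1 <= r <= 1 -> lev t1 r < s < lev t2 r ->
  exists t, t1 < t < t2 /\ lev t r = s.
Proof.
  intros Hr Hs.
  assert (Ht : t1 < t2).
  { apply Rnot_le_lt; intros [H| ->]; [|lra].
    apply (fol_increasing lev lev_fol _ _ r Hr) in H. lra. }
  assert (Hc : continuity (fun t => lev t r - s)).
  { apply continuity_of_eps. intros t eps Heps.
    destruct (fol_continuous lev lev_fol t r Hr eps Heps) as [delta [Hd H]].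
    exists delta. split; auto. intros y Hy.
    replace (lev y r - s - (lev t r - s)) with (lev y r - lev t r) by ring.
    apply H; auto. rewrite Rminus_diag, Rabs_R0. lra. }
  destruct (IVT _ t1 t2 Hc Ht ltac:(lra) ltac:(lra)) as [t [Ht' He]].
  exists t. split; [|lra].
  destruct Ht' as [[H1|H1] [H2|H2]]; subst; lra.
Qed.

Lemma fol_near (t0 : R) (z0 : pt) : closed_sq z0 -> forall eps, eps > 0 ->
  exists delta, delta > 0 /\ forall z, closed_sq z -> d z0 z < delta ->
    Rabs (lev t0 (fst z) - lev t0 (fst z0)) < eps.
Proof.
  intros [Hz _] eps Heps.
  destruct (fol_continuous lev lev_fol t0 (fst z0) Hz eps Heps) as [delta [Hd H]].
  exists delta. split; auto. intros z [Hz1 _] Hzz. apply H; auto.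
  - rewrite Rminus_diag, Rabs_R0. lra.
  - rewrite Rabs_minus_sym. eapply Rle_lt_trans; [apply fst_le_d|]. exact Hzz.
Qed.

(** By the intermediate value theorem a point off the strip lies above all leaves or below all of
    them. It is thus strictly beyond the leaf of time [T] or [- T], and so are its neighbours. *)
Lemma off_strip_far (z0 : pt) (T : R) : closed_sq z0 -> ~ in_strip lev z0 ->
  exists delta, delta > 0 /\ forall z, closed_sq z -> d z0 z < delta ->
    forall t, lev t (fst z) = snd z -> T <= Rabs t.
Proof.
  intros Hz0 Hoff. pose proof Hz0 as [Hr0 _].
  assert (Hside : (forall t, lev t (fst z0) < snd z0) \/ (forall t, snd z0 < lev t (fst z0))).
  { destruct (classic (exists t, snd z0 <= lev t (fst z0))) as [[t1 Ht1]|Hn].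
    - right. intros t. apply Rnot_le_lt. intros Ht.
      destruct Ht1 as [Ht1|Ht1]; [|apply Hoff; exists t1; auto].
      destruct Ht as [Ht|Ht]; [|apply Hoff; exists t; auto].
      destruct (fol_IVT t t1 (fst z0) (snd z0) Hr0) as [t2 [_ Ht2]]; [lra|].
      apply Hoff. exists t2. auto.
    - left. intros t. apply Rnot_le_lt. intros Ht. apply Hn. exists t. exact Ht. }
  destruct Hside as [Hs|Hs].
  - specialize (Hs T).
    destruct (fol_near T z0 Hz0 ((snd z0 - lev T (fst z0)) / 2)) as [delta [Hd H]]; [lra|].
    exists (Rmin delta ((snd z0 - lev T (fst z0)) / 2)). split; [apply Rmin_glb_lt; lra|].
    intros z Hz Hzz t Ht. pose proof (Rmin_l delta ((snd z0 - lev T (fst z0)) / 2)).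
    pose proof (Rmin_r delta ((snd z0 - lev T (fst z0)) / 2)).
    specialize (H z Hz ltac:(lra)). pose proof (snd_le_d z0 z).
    apply Rnot_lt_le; intros Hlt.
    pose proof (fol_increasing lev lev_fol t T (fst z) (proj1 Hz)
      ltac:(pose proof (Rle_abs t); lra)). split_Rabs; lra.
  - specialize (Hs (- T)).
    destruct (fol_near (- T) z0 Hz0 ((lev (- T) (fst z0) - snd z0) / 2)) as [delta [Hd H]]; [lra|].
    exists (Rmin delta ((lev (- T) (fst z0) - snd z0) / 2)). split; [apply Rmin_glb_lt; lra|].
    intros z Hz Hzz t Ht. pose proof (Rmin_l delta ((lev (- T) (fst z0) - snd z0) / 2)).
    pose proof (Rmin_r delta ((lev (- T) (fst z0) - snd z0) / 2)).
    specialize (H z Hz ltac:(lra)). pose proof (snd_le_d z0 z).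
    apply Rnot_lt_le; intros Hlt.
    pose proof (fol_increasing lev lev_fol (- T) t (fst z) (proj1 Hz)
      ltac:(split_Rabs; lra)). split_Rabs; lra.
Qed.

Section Map.

Variables (F : R -> R -> R) (e : R).
Hypothesis F_int : forall t r, -1 <= r <= 1 -> -1 <= F t r <= 1.
Hypothesis F_cont : jointly_continuous F.
Hypothesis F_displacement : forall eta, eta > 0 -> exists T, forall t r,
  T <= Rabs t -> -1 <= r <= 1 ->
  Rabs (F t r - r) + Rabs (lev (t + e) (F t r) - lev t r) < eta.

Lemma strip_map_exists : exists psi, strip_map lev F e psi.
Proof.
  assert (H : forall z, exists z', closed_sq z ->
    (forall t, lev t (fst z) = snd z -> z' = (F t (fst z), lev (t + e) (F t (fst z)))) /\
    (~ in_strip lev z -> z' = z)).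
  { intros z. destruct (classic (closed_sq z)) as [Hz|Hz]; [|exists z; contradiction].
    destruct (classic (in_strip lev z)) as [[t Ht]|Hn].
    - exists (F t (fst z), lev (t + e) (F t (fst z))). intros _. split.
      + intros t' Ht'. rewrite <- Ht in Ht'.
        apply (fol_time_unique t' t (fst z) (proj1 Hz)) in Ht'. subst; auto.
      + intros Hn. exfalso. apply Hn. exists t; auto.
    - exists z. intros _. split; auto. intros t Ht. exfalso. apply Hn. exists t; auto. }
  exists (fun z => proj1_sig (constructive_indefinite_description _ (H z))). split.
  - intros t r Hr.
    destruct (constructive_indefinite_description _ (H (r, lev t r))) as [z' Hz']. simpl.
    destruct Hz' as [Hz' _]; [|apply (Hz' t); reflexivity].
    split; simpl; auto. apply (fol_bounds lev lev_fol); auto.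
  - intros z Hz Hn.
    destruct (constructive_indefinite_description _ (H z)) as [z' Hz']. simpl.
    apply Hz'; auto.
Qed.

Variable psi : pt -> pt.
Hypothesis psi_map : strip_map lev F e psi.

Lemma strip_map_at (z : pt) (t : R) : closed_sq z -> lev t (fst z) = snd z ->
  psi z = (F t (fst z), lev (t + e) (F t (fst z))).
Proof.
  intros [Hz _] Ht. rewrite <- (proj1 psi_map) by auto. rewrite Ht. destruct z; auto.
Qed.

Lemma strip_map_closed (z : pt) : closed_sq z -> closed_sq (psi z).
Proof.
  intros Hz. destruct (classic (in_strip lev z)) as [[t Ht]|Hn].
  - rewrite (strip_map_at z t); auto.
    assert (-1 <= F t (fst z) <= 1) by (apply F_int, Hz).
    split; simpl; auto. apply (fol_bounds lev lev_fol); auto.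
  - rewrite (proj2 psi_map); auto.
Qed.

Lemma strip_map_displacement (eta : R) : eta > 0 -> exists T, forall z, closed_sq z ->
  (forall t, lev t (fst z) = snd z -> T <= Rabs t) -> d (psi z) z < eta.
Proof.
  intros Heta. destruct (F_displacement eta Heta) as [T HT].
  exists T. intros z Hz Hfar.
  destruct (classic (in_strip lev z)) as [[t Ht]|Hn].
  - rewrite (strip_map_at z t) by auto.
    eapply Rle_lt_trans; [apply d_le_sum|]. simpl. rewrite <- Ht.
    apply HT; auto. apply Hz.
  - rewrite (proj2 psi_map), d_refl; auto.
Qed.

(** At a point of the leaf [t0], the leaves [t0 - k] and [t0 + k] trap all neighbours, so time
    depends continuously on the point. Off the strip the point is fixed, and its neighbours either
    have large [|t|] or are fixed, hence hardly move. *)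
Lemma strip_map_continuous : continuous_on_sq psi.
Proof.
  intros z0 Hz0 eps Heps. pose proof Hz0 as [Hr0 Hs0].
  destruct (classic (in_strip lev z0)) as [[t0 Ht0]|Hoff].
  - assert (HF : -1 <= F t0 (fst z0) <= 1) by (apply F_int, Hz0).
    destruct (fol_continuous lev lev_fol (t0 + e) (F t0 (fst z0)) HF (eps / 2) ltac:(lra))
      as [d1 [Hd1 HS]].
    destruct (F_cont t0 (fst z0) Hr0 (Rmin d1 (eps / 2)) ltac:(apply Rmin_glb_lt; lra))
      as [d2 [Hd2 HF2]].
    pose proof (Rmin_l d1 (eps / 2)). pose proof (Rmin_r d1 (eps / 2)).
    set (k := Rmin d1 d2). assert (Hk : 0 < k) by (apply Rmin_glb_lt; lra).
    assert (Hk1 : k <= d1) by apply Rmin_l. assert (Hk2 : k <= d2) by apply Rmin_r.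
    pose proof (fol_increasing lev lev_fol (t0 - k) t0 (fst z0) Hr0 ltac:(lra)) as Hlo.
    pose proof (fol_increasing lev lev_fol t0 (t0 + k) (fst z0) Hr0 ltac:(lra)) as Hhi.
    set (g := Rmin (lev t0 (fst z0) - lev (t0 - k) (fst z0)) (lev (t0 + k) (fst z0) - lev t0 (fst z0))).
    assert (Hg : 0 < g) by (apply Rmin_glb_lt; lra).
    assert (Hg1 : g <= lev t0 (fst z0) - lev (t0 - k) (fst z0)) by apply Rmin_l.
    assert (Hg2 : g <= lev (t0 + k) (fst z0) - lev t0 (fst z0)) by apply Rmin_r.
    destruct (fol_near (t0 - k) z0 Hz0 (g / 2) ltac:(lra)) as [d3 [Hd3 Hn3]].
    destruct (fol_near (t0 + k) z0 Hz0 (g / 2) ltac:(lra)) as [d4 [Hd4 Hn4]].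
    set (dl := Rmin (Rmin d3 d4) (Rmin d2 (g / 2))).
    assert (Hdl : 0 < dl /\ dl <= d3 /\ dl <= d4 /\ dl <= d2 /\ dl <= g / 2).
    { unfold dl. split; [repeat apply Rmin_glb_lt; lra|].
      unfold Rmin. repeat destruct Rle_dec; lra. }
    exists dl. split; [lra|]. intros z Hz Hzz.
    specialize (Hn3 z Hz ltac:(lra)). specialize (Hn4 z Hz ltac:(lra)).
    pose proof (fst_le_d z0 z). pose proof (snd_le_d z0 z).
    destruct (fol_IVT (t0 - k) (t0 + k) (fst z) (snd z) (proj1 Hz)) as [t [Ht Het]].
    { split_Rabs; lra. }
    rewrite (strip_map_at z t), (strip_map_at z0 t0) by auto.
    assert (Htt : Rabs (t - t0) < k) by (apply Rabs_def1; lra).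
    assert (HFz : -1 <= F t (fst z) <= 1) by (apply F_int, Hz).
    assert (HFF : Rabs (F t (fst z) - F t0 (fst z0)) < Rmin d1 (eps / 2)).
    { apply HF2; [apply Hz|lra|]. rewrite Rabs_minus_sym. lra. }
    assert (HSS : Rabs (lev (t + e) (F t (fst z)) - lev (t0 + e) (F t0 (fst z0))) < eps / 2).
    { apply HS; auto; [|lra]. replace (t + e - (t0 + e)) with (t - t0) by ring. lra. }
    rewrite d_sym. eapply Rle_lt_trans; [apply d_le_sum|]. simpl. lra.
  - destruct (strip_map_displacement (eps / 2) ltac:(lra)) as [T HT].
    destruct (off_strip_far z0 T Hz0 Hoff) as [dl [Hdl Hfar]].
    exists (Rmin dl (eps / 2)). split; [apply Rmin_glb_lt; lra|]. intros z Hz Hzz.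
    pose proof (Rmin_l dl (eps / 2)). pose proof (Rmin_r dl (eps / 2)).
    specialize (HT z Hz (Hfar z Hz ltac:(lra))).
    rewrite (proj2 psi_map z0) by auto.
    pose proof (d_tri z0 z (psi z)) as H1. rewrite (d_sym z (psi z)) in H1. lra.
Qed.

Fixpoint orbit (t r : R) (n : nat) : R :=
  match n with
  | O => r
  | S m => F (t + INR m * e) (orbit t r m)
  end.

Lemma orbit_int (t r : R) (n : nat) : -1 <= r <= 1 -> -1 <= orbit t r n <= 1.
Proof. intros Hr. induction n; simpl; auto. Qed.

Lemma iter_strip_map (t r : R) (n : nat) : -1 <= r <= 1 ->
  Defs.iter psi n (r, lev t r) = (orbit t r n, lev (t + INR n * e) (orbit t r n)).
Proof.
  intros Hr. induction n.
  - simpl. rewrite Rmult_0_l, Rplus_0_r. reflexivity.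
  - rewrite iter_S, IHn, (proj1 psi_map) by (apply orbit_int; auto).
    rewrite S_INR. replace (t + (INR n + 1) * e) with (t + INR n * e + e) by ring.
    reflexivity.
Qed.

Lemma iter_off_strip (z : pt) (n : nat) : closed_sq z -> ~ in_strip lev z ->
  Defs.iter psi n z = z.
Proof.
  intros Hz Hn. induction n; [reflexivity|]. rewrite iter_S, IHn. apply psi_map; auto.
Qed.

End Map.

Lemma strip_map_inverse (F F' : R -> R -> R) (e e' : R) (psi phi : pt -> pt) :
  e + e' = 0 ->
  (forall t r, -1 <= r <= 1 -> -1 <= F t r <= 1) ->
  (forall t r, -1 <= r <= 1 -> F' (t + e) (F t r) = r) ->
  strip_map lev F e psi -> strip_map lev F' e' phi ->
  forall z, closed_sq z -> phi (psi z) = z.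
Proof.
  intros He HF HFF Hpsi Hphi z Hz.
  destruct (classic (in_strip lev z)) as [[t Ht]|Hn].
  - rewrite (strip_map_at F e psi Hpsi z t) by auto.
    rewrite (proj1 Hphi) by (apply HF, Hz). rewrite HFF by apply Hz.
    replace (t + e + e') with t by lra. rewrite Ht. destruct z; reflexivity.
  - rewrite (proj2 Hpsi z), (proj2 Hphi z); auto.
Qed.

End Strip.

(** * Pushing abscissas towards a target *)

Lemma contraction_rate (x : nat -> R) (a M : R) (K : nat) : 0 < a -> 1 <= M ->
  (forall j, 0 <= x j) ->
  (forall j, (j >= K)%nat -> x (S j) * (1 + a / (8 * sqrt (INR j + M))) <= x j) ->
  exists C K', (K <= K')%nat /\ forall j, (j >= K')%nat -> x j * (INR j + M) <= C.
Proof.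
  intros Ha HM Hx Hs.
  (* Once [8 / a <= sqrt (j + M)], the contraction [1 + a / (8 * sqrt (j + M))] is at least
     [1 + 1 / (j + M)], the growth of the weight [j + M], so [x j * (j + M)] no longer increases. *)
  destruct (INR_unbounded (8 / a * (8 / a))) as [N HN].
  set (K' := max K N). exists (x K' * (INR K' + M)), K'. split; [unfold K'; lia|].
  intros j Hj. induction Hj as [|j Hj IH]; [lra|].
  assert (HjN : INR N <= INR j) by (apply le_INR; unfold K' in Hj; lia).
  specialize (Hs j ltac:(unfold K' in Hj; lia)).
  pose proof (pos_INR j). eapply Rle_trans; [|apply IH].
  assert (Hq : 8 / a <= sqrt (INR j + M)).
  { rewrite <- (sqrt_square (8 / a)).
    - apply sqrt_le_1_alt. lra.
    - left. apply Rdiv_lt_0_compat; lra. }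
  pose proof (sqrt_sqrt (INR j + M) ltac:(lra)) as Hss.
  assert (Hqp : 0 < sqrt (INR j + M)) by (apply sqrt_lt_R0; lra).
  set (q := sqrt (INR j + M)) in *.
  assert (Hw : 1 / (INR j + M) <= a / (8 * q)).
  { rewrite <- Hss. apply Rmult_le_reg_r with (8 * (q * q)); [nra|].
    replace (1 / (q * q) * (8 * (q * q))) with 8 by (field; lra).
    replace (a / (8 * q) * (8 * (q * q))) with (a * q) by (field; lra).
    apply Rmult_le_compat_l with (r := a) in Hq; [|lra].
    replace (a * (8 / a)) with 8 in Hq by (field; lra). exact Hq. }
  rewrite S_INR.
  replace (x (S j) * (INR j + 1 + M)) with (x (S j) * (1 + 1 / (INR j + M)) * (INR j + M))
    by (field; lra).
  apply Rmult_le_compat_r; [lra|]. pose proof (Hx (S j)). nra.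
Qed.

(** The implicit recursion makes [r (S j)] a weighted mean of [r j] and [beta]. It covers both
    directions: the damping factor [1 - r ^ 2] is taken at the old abscissa for a push and at the
    new one for a pull, hence the minimum. *)
Lemma approach_rate (r : nat -> R) (beta M : R) (K : nat) :
  1 <= M -> -1 < beta < 1 -> -1 < r K < 1 ->
  (forall j, (j >= K)%nat -> exists w, 0 <= w /\
     Rmin (1 - r j ^ 2) (1 - r (S j) ^ 2) / (8 * sqrt (INR j + M)) <= w /\
     (r (S j) - beta) * (1 + w) = r j - beta) ->
  exists C K', forall j, (j >= K')%nat -> Rabs (r j - beta) * (INR j + M) <= C.
Proof.
  intros HM Hb HrK Hstep.
  set (a := Rmin (1 - beta ^ 2) (1 - r K ^ 2)).
  assert (Ha : 0 < a) by (apply Rmin_glb_lt; nra).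
  assert (Hab : a <= 1 - beta ^ 2) by apply Rmin_l.
  assert (Hinv : forall j, (j >= K)%nat -> a <= 1 - r j ^ 2).
  { intros j Hj. induction Hj as [|j Hj IH]; [apply Rmin_r|].
    destruct (Hstep j Hj) as (w & Hw & _ & He).
    assert (Hx : r (S j) * (1 + w) = r j + w * beta) by lra.
    set (x := r (S j)) in *. set (y := r j) in *.
    (* Convexity of the square: a mean of numbers whose squares are at most [1 - a] again has square
       at most [1 - a], so the damping never degenerates. *)
    assert (H1 : (x * (1 + w)) ^ 2 <= (1 + w) * (y ^ 2 + w * beta ^ 2)).
    { rewrite Hx. assert (0 <= w * (y - beta) ^ 2) by (pose proof (pow2_ge_0 (y - beta)); nra).
      nra. }
    assert (H2 : (1 + w) * (x ^ 2 * (1 + w)) <= (1 + w) * ((1 - a) * (1 + w))).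
    { apply Rle_trans with ((1 + w) * (y ^ 2 + w * beta ^ 2)); [nra|].
      apply Rmult_le_compat_l; nra. }
    apply Rmult_le_reg_l in H2; [|lra]. apply Rmult_le_reg_r in H2; lra. }
  destruct (contraction_rate (fun j => Rabs (r j - beta)) a M K Ha HM) as [C [K' [_ H]]].
  - intros j. apply Rabs_pos.
  - intros j Hj. destruct (Hstep j Hj) as (w & Hw & Hwl & He).
    rewrite <- He, Rabs_mult, (Rabs_pos_eq (1 + w)) by lra.
    apply Rmult_le_compat_l; [apply Rabs_pos|]. apply Rplus_le_compat_l.
    eapply Rle_trans; [|apply Hwl]. apply Rmult_le_compat_r.
    + left. apply Rinv_0_lt_compat. pose proof (pos_INR j).
      pose proof (sqrt_lt_R0 (INR j + M) ltac:(lra)). lra.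
    + apply Rmin_glb; apply Hinv; lia.
  - exists C, K'. exact H.
Qed.

(** The sign makes a push attract to the target at positive times and repel from it at negative
    ones, where the inverse then attracts. The factor [1/8] keeps pushes increasing in the
    abscissa. *)
Definition speed (t : R) : R := clip (-1) 1 t / (8 * sqrt (1 + Rabs t)).

Lemma sqrt_1_plus_abs (t : R) : 1 <= sqrt (1 + Rabs t).
Proof.
  rewrite <- sqrt_1 at 1. apply sqrt_le_1_alt. pose proof (Rabs_pos t). lra.
Qed.

Lemma speed_bound (t : R) : Rabs (speed t) * (8 * sqrt (1 + Rabs t)) <= 1.
Proof.
  pose proof (sqrt_1_plus_abs t) as Hq. set (q := sqrt (1 + Rabs t)) in *.
  rewrite <- (Rabs_pos_eq (8 * q)) by lra. rewrite <- Rabs_mult. unfold speed. fold q.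
  replace (clip (-1) 1 t / (8 * q) * (8 * q)) with (clip (-1) 1 t) by (field; lra).
  apply Rabs_le. apply clip_bounds. lra.
Qed.

Lemma speed_small (t : R) : -1 / 8 <= speed t <= 1 / 8.
Proof.
  pose proof (sqrt_1_plus_abs t) as Hq. pose proof (speed_bound t).
  pose proof (Rabs_pos (speed t)). assert (Rabs (speed t) <= 1 / 8) by nra.
  split_Rabs; lra.
Qed.

Lemma speed_pos (t : R) : 1 <= t -> speed t = / (8 * sqrt (1 + Rabs t)).
Proof. intros H. unfold speed. rewrite clip_high by lra. unfold Rdiv. ring. Qed.

Lemma speed_neg (t : R) : t <= -1 -> speed t = - / (8 * sqrt (1 + Rabs t)).
Proof. intros H. unfold speed. rewrite clip_low by lra. unfold Rdiv. ring. Qed.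

Lemma continuity_speed : continuity speed.
Proof.
  assert (Hs : continuity (fun t => 8 * sqrt (1 + Rabs t))).
  { apply (continuity_mult (fun _ => 8)); [apply continuity_cst|].
    intros t. apply (continuity_pt_comp (fun t => 1 + Rabs t) sqrt).
    - apply (continuity_pt_plus (fun _ => 1) Rabs); [apply continuity_cst|apply Rcontinuity_abs].
    - apply continuity_pt_sqrt. pose proof (Rabs_pos t). lra. }
  apply (continuity_div (clip (-1) 1) _ (continuity_clip _ _) Hs).
  intros t. pose proof (sqrt_1_plus_abs t). lra.
Qed.

Section Push.

Variable c : R -> R.
Hypothesis c_cont : continuity c.
Hypothesis c_int : forall t, -1 <= c t <= 1.

(** The factor [1 - r ^ 2] pins the vertical sides of the square. *)
Definition push (t r : R) : R := r + speed t * (1 - r ^ 2) * (c t - r).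

(** The shift by [1] is there because the inverse, at time [t], undoes the push that started at time
    [t - 1]. *)
Definition pull (t r : R) : R :=
  epsilon (inhabits 0) (fun x => -1 <= x <= 1 /\ push (t - 1) x = r).

Lemma push_diff (t r r' : R) : -1 <= r <= 1 -> -1 <= r' <= 1 -> r <= r' ->
  (r' - r) / 4 <= push t r' - push t r <= 2 * (r' - r).
Proof.
  intros Hr Hr' Hrr. pose proof (speed_small t) as Hm. pose proof (c_int t) as Hc.
  unfold push. set (m := speed t) in *. set (b := c t) in *.
  replace (r' + m * (1 - r' ^ 2) * (b - r') - (r + m * (1 - r ^ 2) * (b - r)))
    with ((r' - r) * (1 - m * (1 + b * (r + r') - (r ^ 2 + r * r' + r' ^ 2)))) by ring.
  set (w := 1 + b * (r + r') - (r ^ 2 + r * r' + r' ^ 2)).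
  (* With a speed of at most [1/8], this leaves a difference quotient between [1/4] and [7/4]. *)
  assert (Hw : -6 <= w <= 6) by (unfold w; nra).
  assert (Hmw : -3 / 4 <= m * w <= 3 / 4) by nra. nra.
Qed.

Lemma push_m1 (t : R) : push t (-1) = -1.
Proof. unfold push. ring. Qed.

Lemma push_1 (t : R) : push t 1 = 1.
Proof. unfold push. ring. Qed.

Lemma push_int (t r : R) : -1 <= r <= 1 -> -1 <= push t r <= 1.
Proof.
  intros Hr. pose proof (push_diff t (-1) r ltac:(lra) Hr ltac:(lra)).
  pose proof (push_diff t r 1 Hr ltac:(lra) ltac:(lra)).
  rewrite push_m1, push_1 in *. lra.
Qed.

Lemma push_open (t r : R) : -1 < r < 1 -> -1 < push t r < 1.
Proof.
  intros Hr. pose proof (push_diff t (-1) r ltac:(lra) ltac:(lra) ltac:(lra)).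
  pose proof (push_diff t r 1 ltac:(lra) ltac:(lra) ltac:(lra)).
  rewrite push_m1, push_1 in *. lra.
Qed.

Lemma push_lip (t r r' : R) : -1 <= r <= 1 -> -1 <= r' <= 1 ->
  Rabs (r' - r) / 4 <= Rabs (push t r' - push t r) <= 2 * Rabs (r' - r).
Proof.
  intros Hr Hr'. destruct (Rle_dec r r') as [H|H].
  - pose proof (push_diff t r r' Hr Hr' H). split_Rabs; lra.
  - pose proof (push_diff t r' r Hr' Hr ltac:(lra)). split_Rabs; lra.
Qed.

Lemma push_onto (t y : R) : -1 <= y <= 1 -> exists x, -1 <= x <= 1 /\ push t x = y.
Proof.
  intros Hy.
  assert (Hc : continuity (fun x => push t x - y)).
  { apply derivable_continuous. unfold push. reg. }
  destruct (IVT_cor _ (-1) 1 Hc ltac:(lra)) as [x [Hx He]].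
  { rewrite push_m1, push_1. nra. }
  exists x. split; auto. lra.
Qed.

Lemma pull_spec (t r : R) : -1 <= r <= 1 ->
  -1 <= pull t r <= 1 /\ push (t - 1) (pull t r) = r.
Proof.
  intros Hr. apply (epsilon_spec (inhabits 0)
    (fun x => -1 <= x <= 1 /\ push (t - 1) x = r)). apply push_onto; auto.
Qed.

Lemma push_inj (t x y : R) : -1 <= x <= 1 -> -1 <= y <= 1 -> push t x = push t y -> x = y.
Proof.
  intros Hx Hy He. pose proof (push_lip t x y Hx Hy) as H. rewrite He, Rminus_diag, Rabs_R0 in H.
  split_Rabs; lra.
Qed.

Lemma pull_push (t r : R) : -1 <= r <= 1 -> pull (t + 1) (push t r) = r.
Proof.
  intros Hr. destruct (pull_spec (t + 1) (push t r)) as [H1 H2]; [apply push_int; auto|].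
  replace (t + 1 - 1) with t in H2 by ring. apply (push_inj t); auto.
Qed.

Lemma push_time_cont (r t0 eps : R) : eps > 0 -> exists delta, delta > 0 /\
  forall t, Rabs (t - t0) < delta -> Rabs (push t r - push t0 r) < eps.
Proof.
  intros Heps. apply (eps_of_continuity (fun t => push t r)); auto.
  apply (continuity_plus (fun _ => r)); [apply continuity_cst|].
  apply (continuity_mult (fun t => speed t * (1 - r ^ 2))).
  - apply (continuity_mult speed); [apply continuity_speed|apply continuity_cst].
  - apply (continuity_minus c); [auto|apply continuity_cst].
Qed.

Lemma push_continuous : jointly_continuous push.
Proof.
  intros t0 r0 Hr0 eps Heps.
  destruct (push_time_cont r0 t0 (eps / 2) ltac:(lra)) as [dl [Hdl H]].
  exists (Rmin dl (eps / 4)). split; [apply Rmin_glb_lt; lra|].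
  pose proof (Rmin_l dl (eps / 4)). pose proof (Rmin_r dl (eps / 4)).
  intros t r Hr Ht Hrr. specialize (H t ltac:(lra)).
  pose proof (push_lip t r0 r Hr0 Hr). split_Rabs; lra.
Qed.

(** A push shrinks distances by at most the factor [4], uniformly in time, so continuity of [push]
    in time carries over to its inverse. *)
Lemma pull_continuous : jointly_continuous pull.
Proof.
  intros t0 r0 Hr0 eps Heps. destruct (pull_spec t0 r0 Hr0) as [Hx0 He0].
  destruct (push_time_cont (pull t0 r0) (t0 - 1) (eps / 8) ltac:(lra)) as [dl [Hdl H]].
  exists (Rmin dl (eps / 8)). split; [apply Rmin_glb_lt; lra|].
  pose proof (Rmin_l dl (eps / 8)). pose proof (Rmin_r dl (eps / 8)).
  intros t r Hr Ht Hrr. destruct (pull_spec t r Hr) as [Hx He].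
  specialize (H (t - 1) ltac:(replace (t - 1 - (t0 - 1)) with (t - t0) by ring; lra)).
  pose proof (push_lip (t - 1) (pull t0 r0) (pull t r) Hx0 Hx).
  split_Rabs; lra.
Qed.

Lemma push_displacement (t r : R) : -1 <= r <= 1 ->
  Rabs (push t r - r) * (4 * sqrt (1 + Rabs t)) <= 1.
Proof.
  intros Hr. unfold push. pose proof (speed_bound t) as Hs. pose proof (c_int t) as Hc.
  pose proof (sqrt_1_plus_abs t) as Hq. set (q := sqrt (1 + Rabs t)) in *.
  replace (r + speed t * (1 - r ^ 2) * (c t - r) - r)
    with (speed t * ((1 - r ^ 2) * (c t - r))) by ring.
  rewrite Rabs_mult.
  assert (Rabs ((1 - r ^ 2) * (c t - r)) <= 2).
  { rewrite Rabs_mult, (Rabs_pos_eq (1 - r ^ 2)) by nra.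
    pose proof (Rabs_pos (c t - r)). assert (Rabs (c t - r) <= 2) by (split_Rabs; lra). nra. }
  pose proof (Rabs_pos (speed t)).
  assert (0 <= Rabs (speed t) * q) by nra. nra.
Qed.

Lemma push_orbit_rate (T r beta M : R) (K : nat) :
  -1 < r < 1 -> -1 < beta < 1 -> Rabs T + 1 <= M ->
  (forall k, (k >= K)%nat -> c (T + INR k) = beta) ->
  exists C K', forall j, (j >= K')%nat ->
    Rabs (orbit push 1 T r j - beta) * (INR j + M) <= C.
Proof.
  intros Hr Hb HM Hc. pose proof (Rabs_pos T).
  destruct (INR_unbounded (Rabs T + 1)) as [N HN].
  assert (Hopen : forall j, -1 < orbit push 1 T r j < 1).
  { induction j; simpl; auto. apply push_open; auto. }
  apply (approach_rate _ beta M (max K N)); auto; [lra|].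
  intros j Hj. cbn [orbit]. rewrite Rmult_1_r. specialize (Hopen j).
  set (y := orbit push 1 T r j) in *.
  assert (HNj : INR N <= INR j) by (apply le_INR; lia).
  assert (Hd : push (T + INR j) y - beta = (y - beta) * (1 - speed (T + INR j) * (1 - y ^ 2))).
  { unfold push. rewrite Hc by lia. ring. }
  pose proof (speed_small (T + INR j)) as Hss.
  assert (HTj : 1 <= T + INR j) by (split_Rabs; lra).
  pose proof (speed_pos (T + INR j) HTj) as Hsp.
  pose proof (sqrt_1_plus_abs (T + INR j)) as Hq.
  assert (Hqq : sqrt (1 + Rabs (T + INR j)) <= sqrt (INR j + M)).
  { apply sqrt_le_1_alt. split_Rabs; lra. }
  set (m := speed (T + INR j)) in *. set (z := push (T + INR j) y) in *.
  assert (Hm : / (8 * sqrt (INR j + M)) <= m).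
  { rewrite Hsp. apply Rinv_le_contravar; lra. }
  assert (Hmp : 0 < / (8 * sqrt (INR j + M))) by (apply Rinv_0_lt_compat; lra).
  assert (Hv : 0 < 1 - y ^ 2 <= 1) by nra.
  set (v := m * (1 - y ^ 2)) in *.
  assert (Hv1 : 0 <= v <= 1 / 8) by (unfold v; nra).
  (* The explicit contraction [1 - v] is rewritten as [1 / (1 + w)]; this [w] is at least [v]. *)
  exists (v / (1 - v)). split; [|split].
  - apply Rmult_le_pos; [lra|]. left. apply Rinv_0_lt_compat. lra.
  - apply Rle_trans with v.
    + unfold v, Rdiv. rewrite (Rmult_comm (Rmin _ _)).
      apply Rmult_le_compat; [lra| |lra|apply Rmin_l].
      apply Rmin_glb; pose proof (push_open (T + INR j) y Hopen); unfold z; nra.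
    + apply Rmult_le_reg_r with (1 - v); [lra|].
      replace (v / (1 - v) * (1 - v)) with v by (field; lra). nra.
  - rewrite Hd. field. lra.
Qed.

Lemma pull_orbit_rate (T r beta M : R) (K : nat) :
  -1 < r < 1 -> -1 < beta < 1 -> Rabs T + 2 <= M ->
  (forall k, (k >= K)%nat -> c (T - INR k) = beta) ->
  exists C K', forall j, (j >= K')%nat ->
    Rabs (orbit pull (-1) T r j - beta) * (INR j + M) <= C.
Proof.
  intros Hr Hb HM Hc. pose proof (Rabs_pos T).
  destruct (INR_unbounded (Rabs T + 1)) as [N HN].
  assert (Hpo : forall t y, -1 < y < 1 -> -1 < pull t y < 1).
  { intros t y Hy. destruct (pull_spec t y ltac:(lra)) as [H1 H2].
    assert (pull t y <> 1) by (intros E; rewrite E, push_1 in H2; lra).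
    assert (pull t y <> -1) by (intros E; rewrite E, push_m1 in H2; lra). lra. }
  assert (Hopen : forall j, -1 < orbit pull (-1) T r j < 1).
  { induction j; simpl; auto. }
  apply (approach_rate _ beta M (max K N)); auto; [lra|].
  intros j Hj. pose proof (Hopen (S j)) as Hx. cbn [orbit] in *. specialize (Hopen j).
  set (y := orbit pull (-1) T r j) in *.
  assert (HNj : INR N <= INR j) by (apply le_INR; lia).
  destruct (pull_spec (T + INR j * -1) y ltac:(lra)) as [_ He].
  set (x := pull (T + INR j * -1) y) in *.
  replace (T + INR j * -1 - 1) with (T - INR (S j)) in He by (rewrite S_INR; ring).
  set (t := T - INR (S j)) in *.
  assert (Ht : t = T - (INR j + 1)) by (unfold t; rewrite S_INR; ring).
  unfold push in He. unfold t in He at 2. rewrite Hc in He by lia.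
  pose proof (speed_small t) as Hss.
  pose proof (speed_neg t ltac:(split_Rabs; lra)) as Hsn.
  pose proof (sqrt_1_plus_abs t) as Hq.
  assert (Hqq : sqrt (1 + Rabs t) <= sqrt (INR j + M)).
  { apply sqrt_le_1_alt. split_Rabs; lra. }
  set (m := speed t) in *.
  assert (Hm : / (8 * sqrt (INR j + M)) <= - m).
  { rewrite Hsn, Ropp_involutive. apply Rinv_le_contravar; lra. }
  assert (Hmp : 0 < / (8 * sqrt (INR j + M))) by (apply Rinv_0_lt_compat; lra).
  assert (Hv : 0 < 1 - x ^ 2 <= 1) by nra.
  (* Going backwards the recursion is implicit from the outset: [y] is the push of [x] at a time of
     negative speed [m]. *)
  exists (- m * (1 - x ^ 2)). split; [|split].
  - apply Rmult_le_pos; lra.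
  - rewrite (Rmult_comm (- m)). unfold Rdiv.
    apply Rle_trans with ((1 - x ^ 2) * / (8 * sqrt (INR j + M))).
    + apply Rmult_le_compat_r; [lra|apply Rmin_r].
    + apply Rmult_le_compat_l; lra.
  - rewrite <- He. ring.
Qed.

End Push.

(** The new time of a point is its old time plus [slant] times its abscissa, so points with distinct
    abscissas can be given distinct phases. *)
Definition leaf (h b k b' : nat -> R) (L0 slant t r : R) : R :=
  leaf0 h b k b' L0 (t - slant * r) r.

Lemma leaf_foliation (h b k b' : nat -> R) (L0 slant : R) :
  (forall n, -1 < h n <= 1) -> (forall n, -1 < k n <= 1) ->
  (forall n, -1 <= b n <= 1) -> (forall n, -1 <= b' n <= 1) -> 0 <= L0 ->
  (forall L L' r, L0 <= L -> L0 <= L' -> 0 < env h b L r + env k b' L' r) ->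
  0 <= slant <= 1 -> foliation (leaf h b k b' L0 slant).
Proof.
  intros Hh Hk Hb Hb' HL0 Hsep Hsl. split.
  - intros t r _. apply leaf0_bounds; auto.
  - intros t t' r _ Ht. apply leaf0_increasing; auto. lra.
  - intros t0 r0 Hr0 eps Heps. unfold leaf.
    set (u0 := t0 - slant * r0). set (G := L0 + slope (Rabs u0)).
    assert (HG : 0 <= G) by (unfold G; pose proof (slope_ge_1 (Rabs u0)); lra).
    (* Slanted times differ by less than twice this bound, which costs [12] by [leaf0_lip_time]; the
       abscissa costs [G]. *)
    exists (eps / (13 + G)). assert (Hd : 0 < eps / (13 + G)) by (apply Rdiv_lt_0_compat; lra).
    split; [lra|]. intros t r Hr Ht Hrr.
    pose proof (leaf0_lip_time h b k b' L0 Hh Hk Hb Hb' HL0 Hsep (t - slant * r) u0 r Hr) as H1.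
    pose proof (leaf0_lip h b k b' L0 Hh Hk HL0 u0 r r0) as H2. fold G in H2.
    assert (H3 : Rabs (t - slant * r - u0) <= Rabs (t - t0) + Rabs (r - r0)).
    { unfold u0. replace (t - slant * r - (t0 - slant * r0))
        with (t - t0 + - (slant * (r - r0))) by ring.
      eapply Rle_trans; [apply Rabs_triang|]. rewrite Rabs_Ropp, Rabs_mult.
      rewrite (Rabs_pos_eq slant) by lra. pose proof (Rabs_pos (r - r0)). nra. }
    set (dl := eps / (13 + G)) in *.
    assert (He : eps = dl * (13 + G)) by (unfold dl; field; lra).
    set (x := leaf0 h b k b' L0 (t - slant * r) r) in *.
    set (y := leaf0 h b k b' L0 u0 r) in *.
    assert (G * Rabs (r - r0) <= G * dl) by (apply Rmult_le_compat_l; lra).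
    replace (x - leaf0 h b k b' L0 u0 r0) with ((x - y) + (y - leaf0 h b k b' L0 u0 r0)) by ring.
    eapply Rle_lt_trans; [apply Rabs_triang|]. nra.
Qed.

Lemma leaf_displacement (h b k b' : nat -> R) (L0 slant eta : R) :
  (forall n, -1 < h n <= 1) -> (forall n, -1 < k n <= 1) ->
  (forall n, -1 <= b n <= 1) -> (forall n, -1 <= b' n <= 1) -> 0 <= L0 ->
  (forall L L' r, L0 <= L -> L0 <= L' -> 0 < env h b L r + env k b' L' r) ->
  0 <= slant <= 1 -> eta > 0 ->
  exists T0, forall T r r', T0 <= Rabs T -> -1 <= r <= 1 -> -1 <= r' <= 1 ->
    Rabs (r' - r) * (4 * sqrt (1 + Rabs T)) <= 1 ->
    Rabs (r' - r) +
      Rabs (leaf h b k b' L0 slant (T + 1) r' - leaf h b k b' L0 slant T r) < eta.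
Proof.
  intros Hh Hk Hb Hb' HL0 Hsep Hsl Heta.
  assert (Hsep' : forall L L' r, L0 <= L -> L0 <= L' -> 0 < env k b' L r + env h b L' r).
  { intros L L' r HL HL'. rewrite Rplus_comm. auto. }
  destruct (leaf0_displacement h b k b' L0 Hh Hk Hb Hb' HL0 Hsep (eta / 2) ltac:(lra))
    as [T1 [HT1 Hup]].
  destruct (leaf0_displacement k b' h b L0 Hk Hh Hb' Hb HL0 Hsep' (eta / 2) ltac:(lra))
    as [T2 [HT2 Hdown]].
  (* Beyond [T3] the root is at least [/ eta], so the horizontal step is at most [eta / 4]. *)
  set (T3 := / eta * / eta).
  exists (Rmax T3 (Rmax T1 T2)). intros T r r' HT Hr Hr' Hd.
  pose proof (Rmax_l T3 (Rmax T1 T2)). pose proof (Rmax_r T3 (Rmax T1 T2)).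
  pose proof (Rmax_l T1 T2). pose proof (Rmax_r T1 T2).
  assert (Hsmall : Rabs (r' - r) < eta / 2).
  { assert (He : 0 < / eta) by (apply Rinv_0_lt_compat; lra).
    assert (Hq : / eta <= sqrt (1 + Rabs T)).
    { rewrite <- (sqrt_square (/ eta)) by lra. apply sqrt_le_1_alt. unfold T3 in *. lra. }
    pose proof (Rabs_pos (r' - r)) as Hp.
    assert (Hm : Rabs (r' - r) * (4 * / eta) <= 1).
    { eapply Rle_trans; [|apply Hd]. apply Rmult_le_compat_l; lra. }
    apply Rmult_le_compat_r with (r := eta / 4) in Hm; [|lra].
    replace (Rabs (r' - r) * (4 * / eta) * (eta / 4)) with (Rabs (r' - r)) in Hm by (field; lra).
    lra. }
  assert (-1 <= slant * r <= 1) by nra. assert (-1 <= slant * r' <= 1) by nra.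
  unfold leaf. destruct (Rle_dec 0 T) as [HT0|HT0].
  - rewrite (Rabs_pos_eq T) in HT, Hd by auto.
    specialize (Hup T (T - slant * r) (T + 1 - slant * r') r r'
      ltac:(lra) ltac:(lra) ltac:(lra) Hr Hd). lra.
  - rewrite (Rabs_left T) in HT, Hd by lra.
    (* Negative times are read on the exchanged combs, where they are positive. *)
    specialize (Hdown (- T) (- T + slant * r) (- T - 1 + slant * r') r r'
      ltac:(lra) ltac:(lra) ltac:(lra) Hr Hd).
    replace (T - slant * r) with (- (- T + slant * r)) by ring.
    replace (T + 1 - slant * r') with (- (- T - 1 + slant * r')) by ring.
    rewrite !leaf0_opp.
    replace (- leaf0 k b' h b L0 (- T - 1 + slant * r') r' - - leaf0 k b' h b L0 (- T + slant * r) r)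
      with (- (leaf0 k b' h b L0 (- T - 1 + slant * r') r' - leaf0 k b' h b L0 (- T + slant * r) r))
      by ring.
    rewrite Rabs_Ropp. lra.
Qed.

Lemma strip_map_slow (lev F : R -> R -> R) (psi : pt -> pt) :
  foliation lev -> (forall t r, -1 <= r <= 1 -> -1 <= F t r <= 1) ->
  (forall eta, eta > 0 -> exists T, forall t r, T <= Rabs t -> -1 <= r <= 1 ->
     Rabs (F t r - r) + Rabs (lev (t + 1) (F t r) - lev t r) < eta) ->
  strip_map lev F 1 psi -> slow_orbits psi.
Proof.
  intros HS HF HD Hpsi eta Heta.
  destruct (strip_map_displacement lev F 1 HD psi Hpsi eta Heta) as [T HT].
  exists (Z.to_nat (up (2 * T)) + 1)%nat. intros x Hx.
  destruct (classic (in_strip lev x)) as [[t Ht]|Hn].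
  - destruct (time_window t T) as [a Ha]. exists a. intros i Hi.
    rewrite Nat.add_assoc. apply Ha. apply Rnot_le_lt. intros Hle.
    assert (Hxe : x = (fst x, lev t (fst x))) by (rewrite Ht; destruct x; auto).
    apply (Rle_not_lt _ _ Hi). rewrite iter_S. apply HT.
    + apply iter_closed; auto. intros z Hz. eapply strip_map_closed; eauto.
    + intros t' Ht'. rewrite Hxe, (iter_strip_map lev F 1 HF psi Hpsi) in Ht' by apply Hx.
      simpl in Ht'. apply fol_time_unique in Ht'; auto.
      * rewrite Ht', Rmult_1_r. exact Hle.
      * apply orbit_int; auto. apply Hx.
  - exists O. intros i Hi. rewrite !(iter_off_strip lev F 1 psi Hpsi), d_refl in Hi by auto. lra.
Qed.

Lemma cv_infty_of_lower (t : nat -> R) (A : R) : (forall j, INR j + A <= t j) -> cv_infty t.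
Proof.
  intros H B. destruct (INR_unbounded (B - A)) as [N HN]. exists N. intros j Hj.
  apply le_INR in Hj. specialize (H j). lra.
Qed.

(** * The homeomorphism for data with distinct abscissas *)

Section Model.

Variables (h b k b' : nat -> R) (w : nat -> pt) (cl : nat -> nat).
Hypothesis h_int : forall n, -1 < h n < 1.
Hypothesis k_int : forall n, -1 < k n < 1.
Hypothesis b_int : forall n, -1 < b n < 1.
Hypothesis b'_int : forall n, -1 < b' n < 1.
Hypothesis h_cv : Un_cv h 1.
Hypothesis k_cv : Un_cv k 1.
Hypothesis b_inj : forall n m, b n = b m -> n = m.
Hypothesis b'_inj : forall n m, b' n = b' m -> n = m.
Hypothesis b_b' : forall n m, b n <> b' m.
Hypothesis w_open : forall i, open_sq (w i).
Hypothesis w_b : forall i n, b n <> fst (w i).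
Hypothesis w_b' : forall i n, b' n <> fst (w i).
Hypothesis w_sep : forall i j, cl i <> cl j -> fst (w i) <> fst (w j).

Let h_int' n : -1 < h n <= 1. Proof. specialize (h_int n). lra. Qed.
Let k_int' n : -1 < k n <= 1. Proof. specialize (k_int n). lra. Qed.
Let b_int_cl n : -1 <= b n <= 1. Proof. specialize (b_int n). lra. Qed.
Let b'_int_cl n : -1 <= b' n <= 1. Proof. specialize (b'_int n). lra. Qed.

Lemma exists_times (L0 : R) : 0 <= L0 ->
  (forall L L' r, L0 <= L -> L0 <= L' -> 0 < env h b L r + env k b' L' r) ->
  exists t : nat -> R, forall i, leaf0 h b k b' L0 (t i) (fst (w i)) = snd (w i).
Proof.
  intros HL0 Hsep.
  assert (Hsep' : forall L L' r, L0 <= L -> L0 <= L' -> 0 < env k b' L r + env h b L' r).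
  { intros L L' r HL HL'. rewrite Rplus_comm. auto. }
  assert (H : forall i, exists t, leaf0 h b k b' L0 t (fst (w i)) = snd (w i)).
  { intros i. pose proof (w_open i) as [Hr Hs].
    destruct (leaf0_top h b k b' L0 h_int' k_int' HL0 h_cv
      (fst (w i)) (1 - snd (w i)) (w_b i) ltac:(lra)) as [t2 Ht2].
    destruct (leaf0_top k b' h b L0 k_int' h_int' HL0 k_cv
      (fst (w i)) (1 + snd (w i)) (w_b' i) ltac:(lra)) as [t1 Ht1].
    pose proof (leaf_foliation h b k b' L0 0 h_int' k_int' b_int_cl b'_int_cl HL0 Hsep
      ltac:(lra)) as Hf.
    destruct (fol_IVT _ Hf (- t1) t2 (fst (w i)) (snd (w i)) ltac:(lra)) as [t [_ Ht]].
    { unfold leaf. rewrite !Rmult_0_l, !Rminus_0_r, leaf0_opp. lra. }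
    exists t. unfold leaf in Ht. rewrite Rmult_0_l, Rminus_0_r in Ht. exact Ht. }
  exists (fun i => proj1_sig (constructive_indefinite_description _ (H i))).
  intros i. destruct (constructive_indefinite_description _ (H i)). auto.
Qed.

(* [t + slant * r] separates the classes modulo integers: each coincidence
   excludes a single slant, because the abscissas differ. *)
Lemma exists_slant (t : nat -> R) : exists slant, 0 < slant < 1 /\
  forall i j (z : Z), cl i <> cl j ->
    t i + slant * fst (w i) - (t j + slant * fst (w j)) <> IZR z.
Proof.
  set (Bad := fun n x => let (i, q) := Cantor.of_nat n in let (j, m) := Cantor.of_nat q in
    cl i <> cl j /\ t i + x * fst (w i) - (t j + x * fst (w j)) = INR m).
  destruct (exists_avoiding_unique Bad 0 1 ltac:(lra)) as [x [Hx Hn]].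
  { intros n x y. unfold Bad. destruct (Cantor.of_nat n) as [i q].
    destruct (Cantor.of_nat q) as [j m]. intros [Hc Hx] [_ Hy].
    apply Rmult_eq_reg_r with (fst (w i) - fst (w j)); [lra|].
    pose proof (w_sep i j Hc). lra. }
  assert (Hnat : forall i j m, cl i <> cl j ->
    t i + x * fst (w i) - (t j + x * fst (w j)) <> INR m).
  { intros i j m Hc He. apply (Hn (Cantor.to_nat (i, Cantor.to_nat (j, m)))).
    unfold Bad. rewrite !Cantor.cancel_of_to. auto. }
  exists x. split; auto. intros i j z Hc He. destruct (Z_le_dec 0 z) as [Hz|Hz].
  - apply (Hnat i j (Z.to_nat z) Hc). rewrite INR_IZR_INZ, Z2Nat.id; auto.
  (* A negative difference is a positive one for the exchanged pair, so natural numbers suffice in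
     [Bad]. *)
  - apply (Hnat j i (Z.to_nat (- z)) (not_eq_sym Hc)).
    rewrite INR_IZR_INZ, Z2Nat.id, opp_IZR by lia. lra.
Qed.

Lemma model : exists psi phi, homeo_sq psi phi /\ slow_orbits psi /\
  forall i, converges_to psi (w i) (b (cl i), h (cl i)) /\
            converges_to phi (w i) (b' (cl i), - k (cl i)).
Proof.
  destruct (env_separated h b k b' (fun n => proj1 (h_int n)) (fun n => proj1 (k_int n))
    h_cv k_cv b_b') as [L0 [HL0 Hsep]].
  assert (Hsep' : forall L L' r, L0 <= L -> L0 <= L' -> 0 < env k b' L r + env h b L' r).
  { intros L L' r HL HL'. rewrite Rplus_comm. auto. }
  destruct (exists_times L0 HL0 Hsep) as [t Ht].
  destruct (exists_slant t) as [sl [Hsl Hphase]].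
  set (T := fun i => t i + sl * fst (w i)).
  (* Consistency holds because equal phases force equal classes, by [Hphase], and targets depend
     only on the class. *)
  destruct (exists_interpolation T (fun i => b (cl i)) (fun i => b' (cl i))) as (c & Hc & Hci & Hcn);
    auto.
  { intros i j [z Hz]. destruct (Nat.eq_dec (cl i) (cl j)) as [->|Hne]; auto.
    exfalso. apply (Hphase i j z Hne). exact Hz. }
  set (lev := leaf h b k b' L0 sl).
  assert (HS : foliation lev) by (apply leaf_foliation; auto; lra).
  pose proof (push_int c Hci) as Hpush.
  assert (Hpull : forall t r, -1 <= r <= 1 -> -1 <= pull c t r <= 1)
    by (intros; apply pull_spec; auto).
  assert (HD : forall eta, eta > 0 -> exists T, forall t r, T <= Rabs t -> -1 <= r <= 1 ->
     Rabs (push c t r - r) + Rabs (lev (t + 1) (push c t r) - lev t r) < eta).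
  { intros eta Heta.
    destruct (leaf_displacement h b k b' L0 sl eta) as [T0 HT0]; auto; [lra|].
    exists T0. intros u r Hu Hr. apply HT0; auto. apply push_displacement; auto. }
  assert (HD' : forall eta, eta > 0 -> exists T, forall t r, T <= Rabs t -> -1 <= r <= 1 ->
     Rabs (pull c t r - r) + Rabs (lev (t + -1) (pull c t r) - lev t r) < eta).
  { intros eta Heta.
    destruct (leaf_displacement h b k b' L0 sl eta) as [T0 HT0]; auto; [lra|].
    (* [pull] at time [u] retraces a push made at time [u - 1]; the extra [1] keeps [|u - 1|] beyond
       [T0]. *)
    exists (T0 + 1). intros u r Hu Hr. destruct (pull_spec c u r Hr) as [Hx Hxe].
    pose proof (push_displacement c Hci (u - 1) (pull c u r) Hx) as Hdis.
    rewrite Hxe in Hdis.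
    specialize (HT0 (u - 1) (pull c u r) r ltac:(split_Rabs; lra) Hx Hr Hdis).
    replace (u - 1 + 1) with u in HT0 by ring.
    change (u + -1) with (u - 1). fold lev in HT0.
    rewrite (Rabs_minus_sym r), (Rabs_minus_sym (lev u r)) in HT0. exact HT0. }
  destruct (strip_map_exists lev HS (push c) 1) as [psi Hpsi].
  destruct (strip_map_exists lev HS (pull c) (-1)) as [phi Hphi].
  exists psi, phi. split; [|split].
  - split; [|split; [|split; [|split; [|split]]]].
    + apply (strip_map_closed lev HS (push c) 1); auto.
    + apply (strip_map_closed lev HS (pull c) (-1)); auto.
    + apply (strip_map_inverse lev (push c) (pull c) 1 (-1)); auto; [lra|].
      intros; apply pull_push; auto.
    + apply (strip_map_inverse lev (pull c) (push c) (-1) 1); auto; [lra|].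
      intros u r Hr. change (u + -1) with (u - 1). apply pull_spec; auto.
    + apply (strip_map_continuous lev HS (push c) 1); auto. apply push_continuous; auto.
    + apply (strip_map_continuous lev HS (pull c) (-1)); auto. apply pull_continuous; auto.
  - apply (strip_map_slow lev (push c)); auto.
  - intros i. pose proof (w_open i) as [Hri _].
    assert (Hwi : w i = (fst (w i), lev (T i) (fst (w i)))).
    { unfold lev, leaf, T.
      replace (t i + sl * fst (w i) - sl * fst (w i)) with (t i) by ring.
      rewrite Ht. destruct (w i); auto. }
    destruct (Hcn i) as [K HK].
    (* Room for the offsets [1] and [2] of the two rate lemmas and for the slant, which shifts times
       by at most [1]. *)
    set (M := Rabs (T i) + 4). pose proof (Rabs_pos (T i)).
    assert (Hslr : forall r, -1 <= r <= 1 -> -1 <= sl * r <= 1) by (intros; nra).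
    split.
    + destruct (push_orbit_rate c Hci (T i) (fst (w i)) (b (cl i)) M K) as (C & K' & HC);
        auto; [unfold M; lra|intros; apply HK; auto|].
      intros eps Heps.
      set (r := orbit (push c) 1 (T i) (fst (w i))) in *.
      assert (Hr : forall j, -1 <= sl * r j <= 1).
      { intros j. apply Hslr. apply orbit_int; auto. lra. }
      destruct (leaf0_cv h b k b' L0 h_int' k_int' HL0 Hsep h_cv
        (fun n => proj2 (h_int n)) b_inj (cl i) C M K' (fun j => T i + INR j - sl * r j) r)
        with (eps := eps / 2) as [N HN]; auto; try lra.
      * unfold M. lra.
      * intros j _. specialize (Hr j). unfold M. split_Rabs; lra.
      * apply (cv_infty_of_lower _ (T i - 1)). intros j. specialize (Hr j). lra.
      * exists N. intros j Hj. destruct (HN j Hj) as [H1 H2].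
        rewrite Hwi, (iter_strip_map lev (push c) 1 Hpush psi Hpsi) by lra.
        eapply Rle_lt_trans; [apply d_le_sum|]. simpl. fold r.
        unfold lev, leaf. rewrite Rmult_1_r. lra.
    + destruct (pull_orbit_rate c (T i) (fst (w i)) (b' (cl i)) M K) as (C & K' & HC);
        auto; [unfold M; lra|intros; apply HK; auto|].
      intros eps Heps.
      set (r := orbit (pull c) (-1) (T i) (fst (w i))) in *.
      assert (Hr : forall j, -1 <= sl * r j <= 1).
      { intros j. apply Hslr. apply orbit_int; auto. lra. }
      destruct (leaf0_cv k b' h b L0 k_int' h_int' HL0 Hsep' k_cv
        (fun n => proj2 (k_int n)) b'_inj (cl i) C M K' (fun j => INR j - T i + sl * r j) r)
        with (eps := eps / 2) as [N HN]; auto; try lra.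
      * unfold M. lra.
      * intros j _. specialize (Hr j). unfold M. split_Rabs; lra.
      * apply (cv_infty_of_lower _ (- T i - 1)). intros j. specialize (Hr j). lra.
      * exists N. intros j Hj. destruct (HN j Hj) as [H1 H2].
        rewrite Hwi, (iter_strip_map lev (pull c) (-1) Hpull phi Hphi) by lra.
        eapply Rle_lt_trans; [apply d_le_sum|]. simpl. fold r.
        unfold lev, leaf.
        (* Descending to the lower comb is climbing to the upper one for the exchanged data. *)
        replace (T i + INR j * -1 - sl * r j) with (- (INR j - T i + sl * r j)) by ring.
        rewrite leaf0_opp.
        replace (- leaf0 k b' h b L0 (INR j - T i + sl * r j) (r j) - - k (cl i))
          with (- (leaf0 k b' h b L0 (INR j - T i + sl * r j) (r j) - k (cl i))) by ring.
        rewrite Rabs_Ropp. lra.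
Qed.

End Model.

(** * The shear *)

Section Shear.

Variable a : R.
Hypothesis a_small : 0 < a < 1 / 4.

(** The factor [1 - r ^ 2] keeps the square invariant. Heights are untouched, so the convergence of
    the tooth ends to the horizontal sides survives. *)
Definition shear (z : pt) : pt := (fst z + a * (1 - fst z ^ 2) * snd z, snd z).

Definition unshear (z : pt) : pt :=
  (epsilon (inhabits 0)
     (fun r => -1 <= r <= 1 /\ r + a * (1 - r ^ 2) * snd z = fst z), snd z).

Lemma shear_abscissa (r s : R) : -1 <= r <= 1 -> -1 <= s <= 1 ->
  (1 + r) / 2 <= 1 + (r + a * (1 - r ^ 2) * s) /\
  (1 - r) / 2 <= 1 - (r + a * (1 - r ^ 2) * s).
Proof.
  intros Hr Hs. assert (Hm : -1 / 4 <= a * s <= 1 / 4) by nra.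
  replace (1 + (r + a * (1 - r ^ 2) * s)) with ((1 + r) * (1 + a * s * (1 - r))) by ring.
  replace (1 - (r + a * (1 - r ^ 2) * s)) with ((1 - r) * (1 - a * s * (1 + r))) by ring.
  set (m := a * s) in *.
  assert (1 / 2 <= 1 + m * (1 - r)) by nra. assert (1 / 2 <= 1 - m * (1 + r)) by nra.
  split; nra.
Qed.

Lemma shear_closed (z : pt) : closed_sq z -> closed_sq (shear z).
Proof.
  intros [H1 H2]. pose proof (shear_abscissa (fst z) (snd z) H1 H2).
  split; cbn [shear fst snd]; lra.
Qed.

Lemma shear_open (z : pt) : open_sq z -> open_sq (shear z).
Proof.
  intros [H1 H2]. pose proof (shear_abscissa (fst z) (snd z) ltac:(lra) ltac:(lra)).
  split; cbn [shear fst snd]; lra.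
Qed.

Lemma unshear_spec (z : pt) : closed_sq z -> closed_sq (unshear z) /\ shear (unshear z) = z.
Proof.
  intros [H1 H2].
  assert (Hex : exists r, -1 <= r <= 1 /\ r + a * (1 - r ^ 2) * snd z = fst z).
  { assert (Hc : continuity (fun r => r + a * (1 - r ^ 2) * snd z - fst z)).
    { apply derivable_continuous. reg. }
    destruct (IVT_cor _ (-1) 1 Hc ltac:(lra)) as [x [Hx He]]; [nra|].
    exists x. split; auto. lra. }
  pose proof (epsilon_spec (inhabits 0) _ Hex) as He. cbv beta in He.
  destruct He as [H3 H4]. split; [split; auto|].
  unfold shear, unshear. cbn [fst snd]. rewrite H4. destruct z; auto.
Qed.

Lemma shear_lip (z z' : pt) : closed_sq z -> closed_sq z' ->
  d (shear z) (shear z') <= 4 * d z z'.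
Proof.
  intros [H1 H2] [H3 H4]. pose proof (fst_le_d z z'). pose proof (snd_le_d z z').
  eapply Rle_trans; [apply d_le_sum|]. cbn [shear fst snd].
  destruct z as [r s], z' as [r' s']. cbn [shear fst snd] in *.
  replace (r + a * (1 - r ^ 2) * s - (r' + a * (1 - r' ^ 2) * s'))
    with ((r - r') * (1 - a * s * (r + r')) + a * (1 - r' ^ 2) * (s - s')) by ring.
  assert (Hu : 0 <= 1 - a * s * (r + r') <= 2).
  { assert (-1 / 4 <= a * s <= 1 / 4) by nra. nra. }
  assert (Hv : 0 <= a * (1 - r' ^ 2) <= 1 / 4).
  { assert (0 <= 1 - r' ^ 2 <= 1) by nra. nra. }
  set (u := 1 - a * s * (r + r')) in *. set (v := a * (1 - r' ^ 2)) in *.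
  assert (Hb : Rabs ((r - r') * u + v * (s - s')) <= 2 * Rabs (r - r') + Rabs (s - s')).
  { eapply Rle_trans; [apply Rabs_triang|]. rewrite !Rabs_mult.
    rewrite (Rabs_pos_eq u), (Rabs_pos_eq v) by lra.
    pose proof (Rabs_pos (r - r')). pose proof (Rabs_pos (s - s')). nra. }
  lra.
Qed.

(** Yields both injectivity of [shear] and the Lipschitz bound for [unshear]. *)
Lemma shear_expand (z z' : pt) : closed_sq z -> closed_sq z' ->
  d z z' <= 4 * d (shear z) (shear z').
Proof.
  intros [H1 H2] [H3 H4].
  pose proof (fst_le_d (shear z) (shear z')) as Hf.
  pose proof (snd_le_d (shear z) (shear z')) as Hs.
  eapply Rle_trans; [apply (d_le_sum z z')|].
  destruct z as [r s], z' as [r' s']. cbn [shear fst snd] in *.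
  set (D := d (shear (r, s)) (shear (r', s'))) in *.
  replace (r + a * (1 - r ^ 2) * s - (r' + a * (1 - r' ^ 2) * s'))
    with ((r - r') * (1 - a * s * (r + r')) + a * (1 - r' ^ 2) * (s - s')) in Hf by ring.
  assert (Hu : 1 / 2 <= 1 - a * s * (r + r')).
  { assert (-1 / 4 <= a * s <= 1 / 4) by nra. nra. }
  assert (Hv : 0 <= a * (1 - r' ^ 2) <= 1 / 4).
  { assert (0 <= 1 - r' ^ 2 <= 1) by nra. nra. }
  set (u := 1 - a * s * (r + r')) in *. set (v := a * (1 - r' ^ 2)) in *.
  assert (Hb : Rabs (r - r') * u <= Rabs ((r - r') * u + v * (s - s')) + v * Rabs (s - s')).
  { replace (Rabs (r - r') * u) with (Rabs ((r - r') * u + v * (s - s') + - (v * (s - s')))).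
    - eapply Rle_trans; [apply Rabs_triang|]. rewrite Rabs_Ropp, (Rabs_mult v).
      rewrite (Rabs_pos_eq v); lra.
    - replace ((r - r') * u + v * (s - s') + - (v * (s - s'))) with ((r - r') * u) by ring.
      rewrite Rabs_mult, (Rabs_pos_eq u); lra. }
  pose proof (Rabs_pos (r - r')). pose proof (Rabs_pos (s - s')). nra.
Qed.

Lemma unshear_shear (z : pt) : closed_sq z -> unshear (shear z) = z.
Proof.
  intros Hz. destruct (unshear_spec (shear z) (shear_closed z Hz)) as [H1 H2].
  apply d_eq. eapply Rle_trans; [apply shear_expand; auto|]. rewrite H2, d_refl. lra.
Qed.

Lemma unshear_lip (z z' : pt) : closed_sq z -> closed_sq z' ->
  d (unshear z) (unshear z') <= 4 * d z z'.
Proof.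
  intros Hz Hz'. destruct (unshear_spec z Hz) as [H1 H2].
  destruct (unshear_spec z' Hz') as [H3 H4].
  rewrite <- H2 at 2. rewrite <- H4 at 2. apply shear_expand; auto.
Qed.

Definition sheared (f : pt -> pt) (z : pt) : pt := unshear (f (shear z)).

Lemma sheared_closed (f : pt -> pt) (z : pt) : (forall z, closed_sq z -> closed_sq (f z)) ->
  closed_sq z -> closed_sq (sheared f z).
Proof. intros Hf Hz. apply unshear_spec, Hf, shear_closed, Hz. Qed.

Lemma sheared_continuous (f : pt -> pt) : (forall z, closed_sq z -> closed_sq (f z)) ->
  continuous_on_sq f -> continuous_on_sq (sheared f).
Proof.
  intros Hf Hc z Hz eps Heps.
  destruct (Hc (shear z) (shear_closed z Hz) (eps / 4) ltac:(lra)) as [dl [Hdl H]].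
  exists (dl / 4). split; [lra|]. intros z' Hz' Hd.
  pose proof (shear_lip z z' Hz Hz').
  specialize (H (shear z') (shear_closed z' Hz') ltac:(lra)).
  pose proof (unshear_lip (f (shear z)) (f (shear z'))
    ltac:(apply Hf, shear_closed; auto) ltac:(apply Hf, shear_closed; auto)).
  unfold sheared. lra.
Qed.

Lemma sheared_inverse (f g : pt -> pt) : (forall z, closed_sq z -> closed_sq (f z)) ->
  (forall z, closed_sq z -> g (f z) = z) ->
  forall z, closed_sq z -> sheared g (sheared f z) = z.
Proof.
  intros Hf Hgf z Hz. unfold sheared.
  rewrite (proj2 (unshear_spec (f (shear z)) (Hf _ (shear_closed z Hz)))).
  rewrite Hgf by (apply shear_closed; auto). apply unshear_shear; auto.
Qed.

Lemma iter_sheared (f : pt -> pt) (z : pt) (n : nat) :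
  (forall z, closed_sq z -> closed_sq (f z)) -> closed_sq z ->
  Defs.iter (sheared f) n z = unshear (Defs.iter f n (shear z)).
Proof.
  intros Hf Hz. induction n.
  - symmetry. apply unshear_shear; auto.
  - rewrite iter_S, IHn, iter_S. unfold sheared. f_equal. f_equal.
    apply unshear_spec. apply iter_closed; auto. apply shear_closed; auto.
Qed.

Lemma sheared_homeo (f g : pt -> pt) : homeo_sq f g -> homeo_sq (sheared f) (sheared g).
Proof.
  intros (H1 & H2 & H3 & H4 & H5 & H6).
  split; [|split; [|split; [|split; [|split]]]]; intros.
  - apply sheared_closed; auto.
  - apply sheared_closed; auto.
  - apply (sheared_inverse f g); auto.
  - apply (sheared_inverse g f); auto.
  - apply sheared_continuous; auto.
  - apply sheared_continuous; auto.
Qed.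

(** Slow orbits pass through a Lipschitz conjugacy with [eta] divided by the constant, so the
    entropy bound can be applied directly to the conjugate. *)
Lemma sheared_slow (f : pt -> pt) : (forall z, closed_sq z -> closed_sq (f z)) ->
  slow_orbits f -> slow_orbits (sheared f).
Proof.
  intros Hf Hs eta Heta. destruct (Hs (eta / 4) ltac:(lra)) as [L HL]. exists L.
  intros x Hx. destruct (HL (shear x) (shear_closed x Hx)) as [m Hm]. exists m.
  intros i Hi. apply Hm. rewrite !iter_sheared in Hi by auto.
  assert (Hcl : forall j, closed_sq (Defs.iter f j (shear x))).
  { intros j. apply iter_closed; auto. apply shear_closed; auto. }
  pose proof (unshear_lip _ _ (Hcl (S i)) (Hcl i)). lra.
Qed.

Lemma sheared_converges (f : pt -> pt) (w y : pt) : (forall z, closed_sq z -> closed_sq (f z)) ->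
  closed_sq w -> closed_sq y -> converges_to f (shear w) (shear y) -> converges_to (sheared f) w y.
Proof.
  intros Hf Hw Hy Hc eps Heps. destruct (Hc (eps / 4) ltac:(lra)) as [N HN].
  exists N. intros n Hn. specialize (HN n Hn). rewrite iter_sheared by auto.
  rewrite <- (unshear_shear y) by auto.
  pose proof (unshear_lip (Defs.iter f n (shear w)) (shear y)
    ltac:(apply iter_closed; auto; apply shear_closed; auto) (shear_closed y Hy)). lra.
Qed.

End Shear.

(* The abscissa of [shear a z] is affine in [a], so two given points are
   aligned for at most one [a]. *)
Lemma exists_separating_shear (P : nat -> pt) : exists a, 0 < a < 1 / 4 /\
  forall i j, open_sq (P j) -> P i <> P j ->
    fst (shear a (P i)) <> fst (shear a (P j)).
Proof.
  set (Bad := fun n a => let (i, j) := Cantor.of_nat n in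
    open_sq (P j) /\ P i <> P j /\ fst (shear a (P i)) = fst (shear a (P j))).
  destruct (exists_avoiding_unique Bad 0 (1 / 4) ltac:(lra)) as [a [Ha Hn]].
  { intros n x y. unfold Bad. destruct (Cantor.of_nat n) as [i j].
    destruct (P i) as [r s], (P j) as [r' s']. cbn [shear fst snd].
    intros ([Hr _] & Hne & Hx) (_ & _ & Hy). cbn [fst] in Hr.
    apply Rmult_eq_reg_r with ((1 - r' ^ 2) * s' - (1 - r ^ 2) * s); [lra|].
    (* Were the coefficient of [a] zero, the abscissas would agree, and then the heights too, since
       [1 - r ^ 2] is positive in the open square. *)
    intros H0.
    assert (Hrr : r' - r = - x * ((1 - r' ^ 2) * s' - (1 - r ^ 2) * s)) by lra.
    rewrite H0 in Hrr. assert (r' = r) by lra. subst r'.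
    apply Hne. f_equal. apply Rmult_eq_reg_l with (1 - r ^ 2); nra. }
  exists a. split; auto. intros i j Hj Hne He.
  apply (Hn (Cantor.to_nat (i, j))). unfold Bad. rewrite Cantor.cancel_of_to. auto.
Qed.

(** * From the given sets to the model *)

Lemma height_cv (y : nat -> pt) (i : R) : dist_to_tends_to_0 y (J i) ->
  Un_cv (fun n => snd (y n)) i.
Proof.
  intros H eps Heps. destruct (H eps Heps) as [N HN]. exists N. intros n Hn.
  destruct (HN n Hn) as [z [[_ Hz] Hd]]. unfold Rdist. rewrite <- Hz.
  eapply Rle_lt_trans; [apply snd_le_d|]. exact Hd.
Qed.

Lemma open_closed (z : pt) : open_sq z -> closed_sq z.
Proof. intros [H1 H2]. split; lra. Qed.

Lemma countable_family (W : nat -> pt -> Prop) (w0 : pt) : W O w0 ->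
  (forall n, countable_set (W n)) ->
  exists (cl : nat -> nat) (w : nat -> pt),
    (forall i, W (cl i) (w i)) /\ (forall n x, W n x -> exists i, cl i = n /\ w i = x).
Proof.
  intros H0 Hc.
  set (f := fun n => proj1_sig (constructive_indefinite_description _ (Hc n))).
  assert (Hf : forall n x, W n x -> exists k, f n k = x).
  { intros n. unfold f. destruct (constructive_indefinite_description _ (Hc n)); auto. }
  (* The enumeration behind [countable_set] may list points outside the set; their indices are
     redirected to [w0] in class [O]. *)
  set (q := fun i => let (n, k) := Cantor.of_nat i in
    if excluded_middle_informative (W n (f n k)) then (n, f n k) else (O, w0)).
  exists (fun i => fst (q i)), (fun i => snd (q i)). split.
  - intros i. unfold q. destruct (Cantor.of_nat i) as [n k].
    destruct excluded_middle_informative; auto.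
  - intros n x Hx. destruct (Hf n x Hx) as [k Hk]. exists (Cantor.to_nat (n, k)).
    unfold q. rewrite Cantor.cancel_of_to, Hk.
    destruct excluded_middle_informative; [auto|contradiction].
Qed.

Theorem theorem5p1
  (y1 y2 : nat -> pt) (W : nat -> pt -> Prop)
  (* Y_N = {y_n1, y_n2 : n} is a countably infinite set, enumerated without repetition *)
  (Hy1inj : forall n m, y1 n = y1 m -> n = m)
  (Hy2inj : forall n m, y2 n = y2 m -> n = m)
  (Hy12 : forall n m, y1 n <> y2 m)
  (HYsq : forall n, open_sq (y1 n) /\ open_sq (y2 n))
  (HWcount : forall n, countable_set (W n))
  (HWdisj : forall n m x, n <> m -> W n x -> W m x -> False)
  (HWsub : forall n w, W n w ->
     open_sq w /\ (forall m, w <> y1 m /\ w <> y2 m))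
  (HWdense : forall n, dense_in_sq (W n))
  (H1a : dist_to_tends_to_0 y1 (J 1))
  (H1b : dist_to_tends_to_0 y2 (J (-1)))
  (H2 : forall beta, (exists m, beta = p (y1 m) \/ beta = p (y2 m)) ->
     exists eps, eps > 0 /\
       finite_set (fun y => (exists m, y = y1 m \/ y = y2 m) /\
                            beta - eps <= p y <= beta + eps)) :
  exists psi phi : pt -> pt,
    homeo_sq psi phi /\ zero_top_entropy psi /\
    forall n w, W n w ->
      (forall z, omega_limit psi w z <-> z = y1 n) /\
      (forall z, omega_limit phi w z <-> z = y2 n).
Proof.
  (* Density makes [W O] nonempty, which supplies the filler point of the common enumeration. *)
  destruct (HWdense O (0, 0)) with (eps := 1) as [w0 [Hw0 _]]; [split; simpl; lra|lra|].
  destruct (countable_family W w0 Hw0 HWcount) as (cl & w & Hw & Hall).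
  assert (Hopen : forall i, open_sq (w i)) by (intros i; apply (HWsub (cl i)), Hw).
  set (P := fun n => let (k, i) := Cantor.of_nat n in
    match k with O => y1 i | S O => y2 i | _ => w i end).
  destruct (exists_separating_shear P) as [a [Ha Hsep]].
  assert (HP : forall n, open_sq (P n)).
  { intros n. unfold P. destruct (Cantor.of_nat n) as [[|[|k]] i]; auto; apply HYsq. }
  assert (Hinj : forall u v, (exists n, P n = u) -> (exists n, P n = v) -> u <> v ->
    fst (shear a u) <> fst (shear a v)).
  { intros u v [n <-] [m <-] Hne. apply Hsep; auto. }
  assert (HP1 : forall i, exists n, P n = y1 i).
  { intros i. exists (Cantor.to_nat (0%nat, i)). unfold P. rewrite Cantor.cancel_of_to. auto. }
  assert (HP2 : forall i, exists n, P n = y2 i).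
  { intros i. exists (Cantor.to_nat (1%nat, i)). unfold P. rewrite Cantor.cancel_of_to. auto. }
  assert (HPw : forall i, exists n, P n = w i).
  { intros i. exists (Cantor.to_nat (2%nat, i)). unfold P. rewrite Cantor.cancel_of_to. auto. }
  assert (Hs1 : forall n, open_sq (shear a (y1 n))) by (intros; apply shear_open; auto; apply HYsq).
  assert (Hs2 : forall n, open_sq (shear a (y2 n))) by (intros; apply shear_open; auto; apply HYsq).
  destruct (model (fun n => snd (y1 n)) (fun n => fst (shear a (y1 n)))
    (fun n => - snd (y2 n)) (fun n => fst (shear a (y2 n)))
    (fun i => shear a (w i)) cl) as (psi & phi & Hhomeo & Hslow & Hcv).
  - intros n. apply HYsq.
  - intros n. destruct (HYsq n) as [_ [_ H]]. lra.
  - intros n. apply Hs1.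
  - intros n. apply Hs2.
  - apply height_cv; auto.
  - replace 1 with (- (-1)) by ring. apply (CV_opp (fun n => snd (y2 n))). apply height_cv; auto.
  - intros n m He. apply NNPP; intros Hne. apply (Hinj (y1 n) (y1 m)); auto.
  - intros n m He. apply NNPP; intros Hne. apply (Hinj (y2 n) (y2 m)); auto.
  - intros n m. apply Hinj; auto.
  - intros i. apply shear_open; auto.
  - intros i n. apply Hinj; auto. apply not_eq_sym, (HWsub (cl i)), Hw.
  - intros i n. apply Hinj; auto. apply not_eq_sym, (HWsub (cl i)), Hw.
  - intros i j Hc. apply Hinj; auto. intros He. apply (HWdisj (cl i) (cl j) (w i)); auto.
    rewrite He. auto.
  - pose proof Hhomeo as (Hc1 & Hc2 & _).
    exists (sheared a psi), (sheared a phi). split; [|split].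
    + apply sheared_homeo; auto.
    + apply zero_entropy_of_slow_orbits.
      * intros z Hz. apply sheared_closed; auto.
      * apply sheared_slow; auto.
    + intros n x Hx. destruct (Hall n x Hx) as [i [<- <-]].
      destruct (Hcv i) as [H3 H4].
      pose proof (open_closed _ (Hopen i)).
      split; apply omega_limit_of_cv; apply sheared_converges; auto;
        try (apply open_closed, HYsq).
      rewrite Ropp_involutive in H4. exact H4.
Qed.
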